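(* Let $\phi:\mathbb{H}\to\mathbb{C}$ be a conformal map, where $\mathbb{H}=\{z:\operatorname{Im} z>0\}$, let $w_0\in\mathbb{C}\setminus\phi(\mathbb{H})$, and let $\lambda>1$ and $\varepsilon>0$. For $n\ge0$ put \[ I_n=[\lambda^{n-1/2},\lambda^{n+1/2}],\qquad E_n=\{t\in I_n: |\phi(t)-w_0|\ge\varepsilon\}, \] \[ J_n=[n-\tfrac12,n+\tfrac12],\qquad F_n=\{t\in J_n: |\phi(t)-w_0|\ge\varepsilon\}, \] where for $t\in\mathbb{R}$, $\phi(t)$ denotes the angular limit of $\phi$ at $t$ and the sets $E_n$, $F_n$ consist of those $t$ at which this angular limit exists and satisfies the stated inequality. \begin{itemize} \item[(a)] If $\phi(\lambda^n i)\to w_0$ as $n\to\infty$, then \[\sum_{n=0}^{\infty}\frac{1}{\log(\lambda^n/\operatorname{cap}E_n)}<\infty.\] \item[(b)] If $\phi(n+i)\to w_0$ as $n\to\infty$, then \[\sum_{n=0}^{\infty}\frac{1}{\log(1/\operatorname{cap}F_n)}<\infty.\] \end{itemize}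
   Context: $\operatorname{cap}$ denotes logarithmic capacity. The angular limit of $\phi$ at a boundary point $t\in\mathbb{R}=\partial\mathbb{H}$ is the limit of $\phi(z)$ as $z\to t$ within any Stolz angle (sector with vertex $t$ symmetric about the vertical and of opening less than $\pi$) in $\mathbb{H}$. A term with $\operatorname{cap}E_n=0$ (respectively $\operatorname{cap}F_n=0$) is interpreted as $0$. *)

(* Defs.v *)
From HB Require Import structures.
From mathcomp Require Import all_boot all_order all_algebra.
From mathcomp Require Import all_classical all_reals all_analysis.
From mathcomp Require Import complex.
Set Implicit Arguments. Unset Strict Implicit. Unset Printing Implicit Defensive.
Import Order.TTheory GRing.Theory Num.Theory.
Import numFieldNormedType.Exports.
Local Open Scope classical_set_scope.
Local Open Scope ring_scope.

Definition upper_half (R : realType) : set R[i] := [set z : R[i] | 0 < complex.Im z].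
Arguments upper_half R : clear implicits.

Definition holomorphic_on (R : realType) (D : set R[i]) (f : R[i] -> R[i]) :=
  forall z, D z -> derivable (f : R[i]^o -> R[i]^o) z 1.

Definition conformal_on_H (R : realType) (f : R[i] -> R[i]) :=
  holomorphic_on (upper_half R) f /\
  (forall z w, upper_half R z -> upper_half R w -> f z = f w -> z = w).

(* Stolz angle at t of "slope" M: the sector {z in H : |Re z - t| < M Im z},
   with vertex t, symmetric about the vertical, of opening 2 arctan M < pi. *)
Definition stolz (R : realType) (t M : R) : set R[i] :=
  [set z : R[i] | 0 < complex.Im z /\ `|complex.Re z - t| < M * complex.Im z].

Definition angular_lim (R : realType) (f : R[i] -> R[i]) (t : R) (L : R[i]) :=
  forall M : R, 0 < M -> (f : R[i]^o -> R[i]^o) @ within (stolz t M) (nbhs (Complex t 0 : R[i]^o))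
    --> (L : R[i]^o).

Definition log_kernel (R : realType) (x y : R) : \bar R :=
  if x == y then +oo%E else (- ln `|x - y|)%:E.

Definition log_energy (R : realType) (mu : probability R R) : \bar R :=
  (\int[mu]_x \int[mu]_y log_kernel x y)%E.

Definition cap_compact (R : realType) (K : set R) : R :=
  let V := ereal_inf [set log_energy mu |
                      mu in [set mu : probability R R | mu (~` K) = 0%E]] in
  if V is r%:E then expR (- r) else 0.

(* Logarithmic capacity of an arbitrary set E of reals (inner capacity:
   supremum over compact subsets; agrees with cap on compact/Borel sets). *)
Definition log_capacity (R : realType) (E : set R) : R :=
  sup [set cap_compact K | K in [set K : set R | compact K /\ K `<=` E]].

Definition far_set (R : realType) (phi : R[i] -> R[i]) (w0 : R[i]) (eps : R)
  (A : set R) : set R :=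
  [set t | A t /\ exists L, angular_lim phi t L /\ Complex eps 0 <= `|L - w0|].

Definition I_int (R : realType) (lam : R) (n : nat) : set R :=
  [set t | lam `^ (n%:R - 2^-1) <= t <= lam `^ (n%:R + 2^-1)].
Definition J_int (R : realType) (n : nat) : set R :=
  [set t | n%:R - 2^-1 <= t <= n%:R + 2^-1].

Definition cap_term (R : realType) (c num : R) : R :=
  if c == 0 then 0 else (ln (num / c))^-1.

(* Main.v *)
Require Import Defs.
From HB Require Import structures.
From mathcomp Require Import all_boot all_order all_algebra.
From mathcomp Require Import all_classical all_reals all_analysis.
From mathcomp Require Import measurable_realfun.
From mathcomp Require Import complex zify ring lra.
Import Order.TTheory GRing.Theory Num.Theory.
Import numFieldNormedType.Exports.
Local Open Scope classical_set_scope.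
Local Open Scope ring_scope.

(** Over [I_n] (or [J_n]) put a dyadic tree: the node of a dyadic interval is the point
of the upper half plane above its centre, at a height equal to its length. Let
[v = min (|phi - w0|, eps)]. If [t] belongs to the exceptional set then the increments
of [v] along the branch ending at [t] add up to at least [eps / 4], since [v] is small at
the root (by hypothesis) and tends to [eps] along the branch, which stays in a Stolz
angle. Let [D_n] be the sum of the squares of all increments of [v] in the [n]-th tree.

The sum of the [D_n] is finite. By Bloch's theorem the image under [phi] of a small
neighbourhood of an edge contains a disc whose radius is comparable to the increment of
[phi] along that edge. The discs of distinct edges (up to four colours) are disjoint
because [phi] is univalent, and those of the edges on which [v] is not constant lie in
a fixed disc around [w0]. For the latter, a branch [h] of [log (phi - w0)] takes no two
values which differ by [2 pi i], so that Bloch's theorem bounds [|h'(z)| Im z]; this is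
a Harnack inequality for [|phi - w0|].

Let [mu] be a probability measure on the exceptional set. Integrating the lower bound
for the increments, and by Cauchy-Schwarz, the sum of the [mu(Q)^2] over the dyadic
intervals [Q] is at least a constant times [1 / D_n]. But this sum is the integral of the
number of dyadic intervals that contain both [s] and [t], at most
[log_2 (|I_n| / |s - t|)]. Therefore the capacity is at most [|I_n| exp (- c / D_n)]. *)

Set Implicit Arguments.
Unset Strict Implicit.
Unset Printing Implicit Defensive.

(** * Complex norm and bisection *)

(** The truncation at [eps] is needed because [phi] may have an image of infinite area: edges on
    which [|phi - w0| >= eps] at both ends then cost nothing. All trees share one finite area, and
    this is why the sum over [n] converges, not just each [D_n]. Boundary values of [phi] enter only
    through points of a Stolz angle, so no theorem on the existence of angular limits is involved.
    Bloch's theorem takes the place of Koebe's distortion theorems. It costs only constants and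
    follows from Cauchy's estimate. Function theory is developed just as far as this requires, with
    primitives on quadrants in place of contour integrals: a quadrant contains every rectangle
    spanned by two of its points. It suffices for the logarithm, and for Cauchy's estimate once
    circles are unrolled into horizontal segments by the exponential function. *)

Notation normc := ComplexField.Normc.normc.

Section NormC.
Variable R : realType.
Implicit Types (x y z : R[i]) (a b : R).

Lemma normc_ge0 x : 0 <= normc x.
Proof. by case: x => a b; exact: sqrtr_ge0. Qed.

Lemma normcD_le x y : normc (x + y) <= normc x + normc y.
Proof. exact: le_normcD. Qed.

Lemma normcB_le x y : normc (x - y) <= normc x + normc y.
Proof. by rewrite (le_trans (normcD_le _ _)) // normcN. Qed.

Lemma normc_distC x y : normc (x - y) = normc (y - x).
Proof. by rewrite -normcN opprB. Qed.

Lemma normc_dist_le z x y : normc (x - y) <= normc (x - z) + normc (z - y).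
Proof. by rewrite (le_trans _ (normcD_le _ _)) // addrA subrK. Qed.

Lemma normc_eq0 x : (normc x == 0) = (x == 0).
Proof.
apply/eqP/eqP => [/ComplexField.Normc.eq0_normc //|->].
exact: ComplexField.Normc.normc0.
Qed.

Lemma normc_gt0 x : (0 < normc x) = (x != 0).
Proof. by rewrite lt_def normc_eq0 normc_ge0 andbT. Qed.

Lemma normc0E : normc (0 : R[i]) = 0.
Proof. exact: ComplexField.Normc.normc0. Qed.

Lemma normcME x y : normc (x * y) = normc x * normc y.
Proof. exact: ComplexField.Normc.normcM. Qed.

Lemma normcVE x : normc x^-1 = (normc x)^-1.
Proof. exact: ComplexField.Normc.normcV. Qed.

Lemma normc_real a : normc (a%:C)%C = `|a|.
Proof. by rewrite /= expr0n /= addr0 sqrtr_sqr. Qed.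

Lemma normr_normc x : `|x| = ((normc x)%:C)%C.
Proof. by rewrite normc_def; case: x. Qed.

Lemma sqr_normc_def a b : (normc (Complex a b)) ^+ 2 = a ^+ 2 + b ^+ 2.
Proof. by rewrite /= sqr_sqrtr // addr_ge0 ?sqr_ge0. Qed.

Lemma normRe_le x : `|complex.Re x| <= normc x.
Proof.
case: x => a b /=; rewrite -sqrtr_sqr ler_sqrt ?addr_ge0 ?sqr_ge0 //.
by rewrite lerDl sqr_ge0.
Qed.

Lemma normIm_le x : `|complex.Im x| <= normc x.
Proof.
case: x => a b /=; rewrite -sqrtr_sqr ler_sqrt ?addr_ge0 ?sqr_ge0 //.
by rewrite lerDr sqr_ge0.
Qed.

Lemma normc_le_ReIm x : normc x <= `|complex.Re x| + `|complex.Im x|.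
Proof.
case: x => a b /=; rewrite -[leRHS]ger0_norm ?addr_ge0 // -sqrtr_sqr.
rewrite ler_sqrt ?sqr_ge0 // sqrrD !real_normK ?num_real //.
by rewrite lerD2r lerDl mulrn_wge0 ?mulr_ge0.
Qed.

Lemma normc_dot_le x y :
  complex.Re x * complex.Re y + complex.Im x * complex.Im y <= normc x * normc y.
Proof.
apply: (le_trans (ler_norm _)).
rewrite -[leRHS]ger0_norm ?mulr_ge0 ?normc_ge0 // -ler_sqr ?qualifE /= ?normr_ge0 //.
rewrite !real_normK ?num_real // exprMn; case: x y => [u v] [x y].
rewrite !sqr_normc_def /=; have := sqr_ge0 (u * y - v * x); nra.
Qed.

Lemma normc_i : normc ('i : R[i])%C = 1.
Proof. by rewrite /= expr0n expr1n /= add0r sqrtr1. Qed.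

Lemma complex_eta x : x = Complex (complex.Re x) (complex.Im x).
Proof. by case: x. Qed.

Lemma complex_ext x y : complex.Re x = complex.Re y ->
  complex.Im x = complex.Im y -> x = y.
Proof. by case: x y => [a b] [c d] /= -> ->. Qed.

End NormC.

Section Cauchy_geometric.
Variable R : realType.

(** The radius [2 c / 2^k] is the tail of the geometric series, so the intervals of this radius
    about [x k] are nested; [l] is the supremum of their left ends. *)
Lemma geometric_lim (x : R^nat) (c : R) :
  (forall k, `|x k.+1 - x k| <= c / 2 ^+ k) ->
  exists l, forall k, `|x k - l| <= 2 * c / 2 ^+ k.
Proof.
move=> H.
have stepE k : 2 * c / 2 ^+ k.+1 = c / 2 ^+ k.
  by rewrite exprS invfM mulrACA divff ?mul1r // pnatr_eq0.
have dblE k : 2 * c / 2 ^+ k = c / 2 ^+ k + c / 2 ^+ k.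
  by rewrite -mulrA mulr_natl mulr2n.
pose lo k := x k - 2 * c / 2 ^+ k; pose hi k := x k + 2 * c / 2 ^+ k.
have lo_nd : {homo lo : m n / (m <= n)%N >-> m <= n}.
  apply: homo_leq => [//| |k]; first exact: le_trans.
  rewrite /lo stepE dblE; have := H k; rewrite ler_norml => /andP[h1 h2].
  by lra.
have hi_ni : {homo hi : m n / (m <= n)%N >-> n <= m}.
  apply: homo_leq => [//|a b d h1 h2|k]; first exact: (le_trans h2 h1).
  rewrite /hi stepE dblE; have := H k; rewrite ler_norml => /andP[h1 h2].
  by lra.
have c0 : 0 <= c.
  by have := H 0%N; rewrite expr0 divr1; apply: le_trans.
have lohi m n : lo m <= hi n.
  apply: (le_trans (lo_nd _ _ (leq_maxl m n))).
  apply: (le_trans _ (hi_ni _ _ (leq_maxr m n))).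
  rewrite /lo /hi; set t := 2 * c / _; suff : 0 <= t by lra.
  by rewrite divr_ge0 ?exprn_ge0 // mulr_ge0.
have hs : has_sup (range lo).
  by split; [exists (lo 0%N), 0%N|exists (hi 0%N) => _ [m _ <-]].
exists (sup (range lo)) => k.
have h1 : lo k <= sup (range lo) by apply: sup_upper_bound => //; exists k.
have h2 : sup (range lo) <= hi k.
  by apply: ge_sup; [exact: hs.1|move=> _ [m _ <-]].
by rewrite ler_norml; move: h1 h2; rewrite /lo /hi => h1 h2; apply/andP; split; lra.
Qed.

Lemma geometric_limc (x : nat -> R[i]) (c : R) :
  (forall k, normc (x k.+1 - x k) <= c / 2 ^+ k) ->
  exists l, forall k, normc (x k - l) <= 4 * c / 2 ^+ k.
Proof.
move=> H.
have [a ha] : exists l, forall k, `|complex.Re (x k) - l| <= 2 * c / 2 ^+ k.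
  apply: geometric_lim => k; rewrite -raddfB.
  exact: le_trans (normRe_le _) (H k).
have [b hb] : exists l, forall k, `|complex.Im (x k) - l| <= 2 * c / 2 ^+ k.
  apply: geometric_lim => k; rewrite -raddfB.
  exact: le_trans (normIm_le _) (H k).
exists (Complex a b) => k; rewrite (le_trans (normc_le_ReIm _)) //.
have := ha k; have := hb k; case: (x k) => u v /= h1 h2.
by rewrite (le_trans (lerD h2 h1)) // -mulrDl -mulrDl; lra.
Qed.

(** Compactness of a rectangle as an induction principle. If [P] failed, it would fail on a nested
    sequence of quarters, which shrink to a point and so contradict the local hypothesis there. Used
    for Goursat's lemma and for bounding a derivative on a disc. *)
Lemma rectangle_bisection (P : R -> R -> R -> R -> Prop) (x0 y0 w0 h0 : R) :
  0 <= w0 -> 0 <= h0 ->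
  (forall x y w h, 0 <= w -> 0 <= h ->
     P x y (w / 2) (h / 2) -> P (x + w / 2) y (w / 2) (h / 2) ->
     P x (y + h / 2) (w / 2) (h / 2) ->
     P (x + w / 2) (y + h / 2) (w / 2) (h / 2) -> P x y w h) ->
  (forall x y, x0 <= x <= x0 + w0 -> y0 <= y <= y0 + h0 ->
     exists2 d, 0 < d & forall x' y' w h, x' <= x <= x' + w ->
       y' <= y <= y' + h -> w < d -> h < d -> P x' y' w h) ->
  P x0 y0 w0 h0.
Proof.
move=> w0_ge0 h0_ge0 split_P loc; apply: contrapT => nP.
pose W k := w0 / 2 ^+ k; pose H k := h0 / 2 ^+ k.
have W0 k : 0 <= W k by rewrite divr_ge0 ?exprn_ge0.
have H0 k : 0 <= H k by rewrite divr_ge0 ?exprn_ge0.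
have WS k : W k.+1 = W k / 2 by rewrite /W exprSr invfM mulrA.
have HS k : H k.+1 = H k / 2 by rewrite /H exprSr invfM mulrA.
pose bad k (p : R * R) := ~ P p.1 p.2 (W k) (H k).
pose next k (p q : R * R) := (q.1 = p.1 \/ q.1 = p.1 + W k / 2) /\
  (q.2 = p.2 \/ q.2 = p.2 + H k / 2).
have step k p : exists q, bad k p -> bad k.+1 q /\ next k p q.
  have [bp|] := pselect (bad k p); last by exists p.
  apply: contrapT => /forallNP nq; apply: (bp).
  have good u v : (u = p.1 \/ u = p.1 + W k / 2) ->
      (v = p.2 \/ v = p.2 + H k / 2) -> P u v (W k / 2) (H k / 2).
    move=> hu hv; apply: contrapT => nu; apply: (nq (u, v)) => _.
    by rewrite /bad /next /= WS HS.
  by apply: split_P => //; apply: good; auto.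
have [f fP] := @choice _ _ (fun kp q => bad kp.1 kp.2 -> bad kp.1.+1 q /\ next kp.1 kp.2 q)
   (fun kp => step kp.1 kp.2).
pose fix s k : R * R := if k is k'.+1 then f (k', s k') else (x0, y0).
have sbad k : bad k (s k).
  elim: k => [|k ih]; first by rewrite /bad /= /W /H expr0 !divr1.
  exact: (fP (k, s k) ih).1.
have snext k : next k (s k) (s k.+1) := (fP (k, s k) (sbad k)).2.
have nd1 k : (s k).1 <= (s k.+1).1 <= (s k).1 + W k / 2.
  have := W0 k; have [[->|->] _] := snext k => h; apply/andP; split; lra.
have nd2 k : (s k).2 <= (s k.+1).2 <= (s k).2 + H k / 2.
  have := H0 k; have [_ [->|->]] := snext k => h; apply/andP; split; lra.
have lim (u Wk : R^nat) a : (forall k, Wk k = a / 2 ^+ k) -> 0 <= a ->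
    (forall k, u k <= u k.+1 <= u k + Wk k / 2) ->
    exists l, forall k, u k <= l <= u k + Wk k.
  move=> WkE a0 nd; have nd' : {homo u : m n / (m <= n)%N >-> m <= n}.
    apply: homo_leq => [//| |k]; first exact: le_trans.
    by have /andP[] := nd k.
  have WkS k : Wk k.+1 = Wk k / 2 by rewrite !WkE exprSr invfM mulrA.
  have ni' : {homo (fun k => u k + Wk k) : m n / (m <= n)%N >-> n <= m}.
    apply: homo_leq => [//|x y z h1 h2|k]; first exact: (le_trans h2 h1).
    by rewrite WkS; have /andP[] := nd k; lra.
  have Wk0 k : 0 <= Wk k by rewrite WkE divr_ge0 ?exprn_ge0.
  have bnd m n : u m <= u n + Wk n.
    apply: (le_trans (nd' _ _ (leq_maxl m n))).
    apply: (le_trans _ (ni' _ _ (leq_maxr m n))).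
    by rewrite lerDl.
  have hs : has_sup (range u).
    by split; [exists (u 0%N), 0%N|exists (u 0%N + Wk 0%N) => _ [m _ <-]].
  exists (sup (range u)) => k; apply/andP; split.
    by apply: sup_upper_bound => //; exists k.
  by apply: ge_sup; [exact: hs.1|move=> _ [m _ <-]].
have [x hx] := lim (fun k => (s k).1) W w0 (fun=> erefl) w0_ge0 nd1.
have [y hy] := lim (fun k => (s k).2) H h0 (fun=> erefl) h0_ge0 nd2.
have [||d d0 hd] := loc x y.
- by have := hx 0%N; rewrite /W expr0 divr1.
- by have := hy 0%N; rewrite /H expr0 divr1.
have small a : 0 <= a -> exists k, forall j, (k <= j)%N -> a / 2 ^+ j < d.
  move=> a0; exists (Num.truncn (a / d)).+1 => j kj.
  rewrite ltr_pdivrMr ?exprn_gt0 // mulrC -ltr_pdivrMr //.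
  apply: (lt_le_trans (truncnS_gt _)).
  rewrite -natrX ler_nat (leq_trans kj) //.
  exact/ltnW/ltn_expl.
have [k1 hk1] := small w0 w0_ge0; have [k2 hk2] := small h0 h0_ge0.
apply: (sbad (maxn k1 k2)); apply: hd => //.
- by apply: hk1; exact: leq_maxl.
- by apply: hk2; exact: leq_maxr.
Qed.

End Cauchy_geometric.

(** * Complex derivatives *)

Section Derivatives.
Variable R : realType.
Implicit Types (z w c d : R[i]) (f g : R[i] -> R[i]).

(** The norm of [R[i]] has its values in [R[i]]; from here on all radii are real. *)
Lemma nbhs_normcP (z : R[i]^o) (A : set R[i]^o) :
  nbhs z A <-> exists2 d : R, 0 < d & forall w, normc (w - z) < d -> A w.
Proof.
split => [/nbhs_ballP[e /= e0 He]|[d d0 Hd]].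
  have eE : e = ((complex.Re e)%:C)%C by rewrite RRe_real // gtr0_real.
  exists (complex.Re e); first by rewrite -ltcR -eE.
  move=> w wz; apply: He; rewrite /ball /= normr_normc eE ltcR.
  by rewrite normc_distC.
apply/nbhs_ballP; exists ((d%:C)%C : R[i]); first by rewrite /= ltcR.
by move=> w; rewrite /ball /= normr_normc ltcR normc_distC; exact: Hd.
Qed.

Lemma cvg_normcP T (F : set_system T) (FF : Filter F) (f : T -> R[i]^o) (L : R[i]^o) :
  f @ F --> L <-> forall e : R, 0 < e -> F [set x | normc (f x - L) < e].
Proof.
split => [H e e0|H].
  by apply: (H [set w | normc (w - L) < e]); apply/nbhs_normcP; exists e.
move=> A /nbhs_normcP[d d0 Hd]; rewrite /nbhs /=.
by apply: filterS (H d d0) => x /= ?; apply: Hd.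
Qed.

(** The one-constructor inductive fixes the topology [R[i]^o] once and keeps unification from
    unfolding continuity into filters. *)
Inductive ccont f z : Prop := CCont of {for z, continuous (f : R[i]^o -> R[i]^o)}.

Lemma ccontP f z : ccont f z <-> forall e : R, 0 < e ->
  exists2 d : R, 0 < d & forall w, normc (w - z) < d -> normc (f w - f z) < e.
Proof.
split => [[H] e e0|H].
  apply/(nbhs_normcP z [set w | normc (f w - f z) < e]).
  exact: (@cvg_normcP _ (nbhs (z : R[i]^o)) _ f (f z)).1 H e e0.
constructor; apply/(@cvg_normcP _ (nbhs (z : R[i]^o)) _ f (f z)) => e e0.
exact/nbhs_normcP/H.
Qed.

Lemma ccont_cst c z : ccont (fun=> c) z.
Proof. by constructor; exact: cst_continuous. Qed.

Lemma ccont_id z : ccont (fun w => w) z.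
Proof. by constructor; exact: cvg_id. Qed.

Lemma ccontD f g z : ccont f z -> ccont g z -> ccont (fun w => f w + g w) z.
Proof.
move=> [fc] [gc]; constructor; move: fc gc.
exact: (@cvgD R[i] R[i]^o _ (nbhs (z : R[i]^o)) _ (f : R[i]^o -> R[i]^o)
  (g : R[i]^o -> R[i]^o) (f z) (g z)).
Qed.

Lemma ccontN f z : ccont f z -> ccont (fun w => - f w) z.
Proof.
move=> [fc]; constructor; move: fc.
exact: (@cvgN R[i] R[i]^o _ (nbhs (z : R[i]^o)) _ (f : R[i]^o -> R[i]^o) (f z)).
Qed.

Lemma ccontM f g z : ccont f z -> ccont g z -> ccont (fun w => f w * g w) z.
Proof.
move=> [fc] [gc]; constructor; move: fc gc.
exact: (@cvgM R[i] R[i]^o (nbhs (z : R[i]^o)) _ (f : R[i]^o -> R[i]^o)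
  (g : R[i]^o -> R[i]^o) (f z) (g z)).
Qed.

Lemma ccontV z : z != 0 -> ccont (fun w => w^-1) z.
Proof.
by move=> z0; constructor; exact: (@cvgV R[i] R[i]^o (nbhs (z : R[i]^o)) _ id z z0 cvg_id).
Qed.

Lemma ccont_comp f g z : ccont f z -> ccont g (f z) -> ccont (fun w => g (f w)) z.
Proof.
move=> [fc] [gc]; constructor.
exact: (@continuous_comp R[i]^o R[i]^o R[i]^o f g z fc gc).
Qed.

Lemma ccont_local f g z (r : R) : 0 < r -> (forall w, normc (w - z) < r -> f w = g w) ->
  ccont f z -> ccont g z.
Proof.
move=> r0 fg /ccontP fc; apply/ccontP => e e0; have [d d0 Hd] := fc e e0.
exists (Num.min r d); first by rewrite lt_min r0 d0.
move=> w; rewrite lt_min => /andP[wr wd]; rewrite -!fg ?Hd //.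
by rewrite subrr normc0E.
Qed.

(* Caratheodory's form of the derivative: the difference quotient extends continuously. *)
Definition cder f z d := exists q : R[i] -> R[i],
  [/\ q z = d, ccont q z & forall w, f w = f z + q w * (w - z)].

Lemma derivable_cder f z : derivable (f : R[i]^o -> R[i]^o) z 1 -> exists d, cder f z d.
Proof.
move=> df; pose d := lim ((fun h : R[i]^o => h^-1 *: ((f : R[i]^o -> R[i]^o) (h *: (1 : R[i]^o) + z) - f z)) @ 0^').
exists d, (fun w => if w == z then d else (f w - f z) / (w - z)); split.
- by rewrite eqxx.
- apply/ccontP => e e0; rewrite eqxx.
  have : (fun h : R[i]^o => h^-1 *: ((f : R[i]^o -> R[i]^o) (h *: (1 : R[i]^o) + z) - f z)) @ 0^' --> (d : R[i]^o).
    exact: df.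
  move=> /cvg_normcP/(_ e e0)/nbhs_normcP[r r0 Hr]; exists r => // w wz.
  case: eqVneq => [_|wnz]; first by rewrite subrr normc0E.
  have := Hr (w - z); rewrite subr0 => /(_ wz).
  rewrite /= subr_eq0 => /(_ wnz); rewrite -[_ *: (1 : R[i]^o)]/(_ * _) mulr1 subrK.
  by rewrite -[_ *: _]/(_ * _) mulrC.
- move=> w; case: eqVneq => [->|wz]; first by rewrite subrr mulr0 addr0.
  by rewrite divfK ?subr_eq0 // addrC subrK.
Qed.

Lemma cder_cont f z d : cder f z d -> ccont f z.
Proof.
move=> [q [qz qc qE]].
have -> : f = (fun w => f z + q w * (w - z)) by apply/funext.
apply: ccontD; first exact: ccont_cst.
apply: ccontM => //; apply: ccontD; first exact: ccont_id.
exact: ccont_cst.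
Qed.

Lemma cder_eq f z c d : cder f z c -> c = d -> cder f z d.
Proof. by move=> ? <-. Qed.

Lemma cder_cst c z : cder (fun=> c) z 0.
Proof. by exists (fun=> 0); split=> // [|w]; [exact: ccont_cst|rewrite mul0r addr0]. Qed.

Lemma cder_id z : cder (fun w => w) z 1.
Proof. by exists (fun=> 1); split=> // [|w]; [exact: ccont_cst|rewrite mul1r addrC subrK]. Qed.

Lemma cderD f g z c d : cder f z c -> cder g z d -> cder (fun w => f w + g w) z (c + d).
Proof.
move=> [p [pz pc pE]] [q [qz qc qE]]; exists (fun w => p w + q w); split.
- by rewrite pz qz.
- exact: ccontD.
- by move=> w; rewrite {1}pE {1}qE; ring.
Qed.

Lemma cderM f g z c d : cder f z c -> cder g z d ->
  cder (fun w => f w * g w) z (c * g z + f z * d).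
Proof.
move=> [p [pz pc pE]] [q [qz qc qE]]; exists (fun w => p w * g w + f z * q w); split.
- by rewrite pz qz.
- apply: ccontD; apply: ccontM => //; last exact: ccont_cst.
  by apply: (@cder_cont g z d); exists q.
- by move=> w; rewrite {1}pE [g w in LHS]qE {1}(qE w); ring.
Qed.

Lemma cderZ c f z d : cder f z d -> cder (fun w => c * f w) z (c * d).
Proof. by move=> H; apply: cder_eq (cderM (cder_cst c z) H) _; rewrite mul0r add0r. Qed.

Lemma cderN f z d : cder f z d -> cder (fun w => - f w) z (- d).
Proof.
move=> H; have := cderZ (-1) H; rewrite mulN1r.
by under eq_fun do rewrite mulN1r.
Qed.

Lemma cderB f g z c d : cder f z c -> cder g z d -> cder (fun w => f w - g w) z (c - d).
Proof. by move=> Hf Hg; exact: cderD Hf (cderN Hg). Qed.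

Lemma cder_comp f g z c d : cder f z c -> cder g (f z) d ->
  cder (fun w => g (f w)) z (d * c).
Proof.
move=> Hf; have fc := cder_cont Hf; move: Hf => [p [pz pc pE]] [q [qz qc qE]].
exists (fun w => q (f w) * p w); split.
- by rewrite pz qz.
- by apply: ccontM => //; apply: ccont_comp.
- by move=> w; rewrite [LHS]qE {2}(pE w); ring.
Qed.

Lemma cderV z : z != 0 -> cder (fun w => w^-1) z (- (z^-1 * z^-1)).
Proof.
move=> z0; exists (fun w => if w == 0 then (z^-1 * z^-1) else - (w^-1 * z^-1)).
split.
- by rewrite (negbTE z0).
- apply: (@ccont_local (fun w => - (w^-1 * z^-1)) _ _ (normc z)).
  + by rewrite normc_gt0.
  + move=> w; case: eqVneq => [->|//]; by rewrite sub0r normcN ltxx.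
  + by apply: ccontN; apply: ccontM; [exact: ccontV|exact: ccont_cst].
- move=> w; case: eqVneq => [->|w0]; first by rewrite invr0; field.
  by field; rewrite z0 w0.
Qed.

(** Caratheodory's form makes the product and chain rules algebraic; this form serves the
    estimates. *)
Lemma cder_approx f z d : cder f z d <-> forall e : R, 0 < e ->
  exists2 r : R, 0 < r & forall w, normc (w - z) < r ->
    normc (f w - f z - d * (w - z)) <= e * normc (w - z).
Proof.
split => [[q [qz /ccontP qc qE]] e e0|H].
  have [r r0 Hr] := qc e e0; exists r => // w wz.
  have -> : f w - f z - d * (w - z) = (q w - q z) * (w - z) by rewrite qE qz; ring.
  by rewrite normcME ler_wpM2r ?normc_ge0 // ltW // Hr.
exists (fun w => if w == z then d else (f w - f z) / (w - z)); split.
- by rewrite eqxx.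
- apply/ccontP => e e0; rewrite eqxx.
  have e20 : 0 < e / 2 by rewrite divr_gt0.
  have [r r0 Hr] := H _ e20; exists r => // w wz.
  case: eqVneq => [_|wnz]; first by rewrite subrr normc0E.
  have nwz : 0 < normc (w - z) by rewrite normc_gt0 subr_eq0.
  have -> : (f w - f z) / (w - z) - d = (f w - f z - d * (w - z)) / (w - z).
    by field; rewrite subr_eq0.
  rewrite normcME normcVE ltr_pdivrMr //; apply: le_lt_trans (Hr _ wz) _.
  by rewrite ltr_pM2r //; lra.
- move=> w; case: eqVneq => [->|wz]; first by rewrite subrr mulr0 addr0.
  by rewrite divfK ?subr_eq0 // addrC subrK.
Qed.

Lemma cder_unique f z c d : cder f z c -> cder f z d -> c = d.
Proof.
move=> /cder_approx Hc /cder_approx Hd; apply/eqP; rewrite -subr_eq0 -normc_eq0.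
rewrite eq_le normc_ge0 andbT; apply/ler_addgt0Pl => e e0; rewrite addr0.
have e20 : 0 < e / 2 by rewrite divr_gt0.
have [r r0 Hr] := Hc _ e20; have [s s0 Hs] := Hd _ e20.
pose t := Num.min r s / 2.
have t0 : 0 < t by rewrite divr_gt0 // lt_min r0 s0.
pose w := z + ((t%:C)%C : R[i]).
have wz : w - z = (t%:C)%C by rewrite /w addrC addKr.
have nwz : normc (w - z) = t by rewrite wz normc_real gtr0_norm.
have m0 : 0 < Num.min r s by rewrite lt_min r0 s0.
have tr : t < r.
  by apply: lt_le_trans (_ : Num.min r s <= r); [rewrite /t; lra|rewrite ge_min lexx].
have ts : t < s.
  by apply: lt_le_trans (_ : Num.min r s <= s); [rewrite /t; lra|rewrite ge_min lexx orbT].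
have h1 := Hr w; have h2 := Hs w; rewrite nwz in h1 h2.
have E : (c - d) * (w - z) = (f w - f z - d * (w - z)) - (f w - f z - c * (w - z)) by ring.
have : normc (c - d) * t <= e * t.
  rewrite -{1}nwz -normcME E (le_trans (normcB_le _ _)) //.
  by rewrite (le_trans (lerD (h2 ts) (h1 tr))) // -mulrDl; lra.
by rewrite ler_pM2r.
Qed.

(** Derivative of a curve, taken by components so that the real mean value theorem and the
    fundamental theorem of calculus apply. *)
Definition rder (P : R -> R[i]) (t : R) (d : R[i]) :=
  is_derive t (1 : R) (fun s => complex.Re (P s)) (complex.Re d) /\
  is_derive t (1 : R) (fun s => complex.Im (P s)) (complex.Im d).

Lemma is_derive_approx (g : R -> R) (t d : R) :
  (forall e : R, 0 < e -> exists2 r : R, 0 < r & forall s, `|s - t| < r ->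
     `|g s - g t - d * (s - t)| <= e * `|s - t|) -> is_derive t (1 : R) g d.
Proof.
move=> H.
have lim_d : (fun h : R => h^-1 *: (g (h *: (1 : R) + t) - g t)) @ 0^' --> d.
  apply/cvgrPdist_le => e e0; have [r r0 Hr] := H _ e0.
  apply/nbhs_ballP; exists r => //= h; rewrite /ball /= sub0r normrN => hr h0.
  have := Hr (h + t); rewrite addrK => /(_ hr).
  rewrite -[h *: 1]/(h * 1) mulr1 -[_ *: _]/(_ * _) => hle.
  have -> : d - h^-1 * (g (h + t) - g t) = - ((g (h + t) - g t - d * h) / h).
    by field.
  by rewrite normrN normrM normfV ler_pdivrMr ?normr_gt0.
apply: DeriveDef; first by apply/cvg_ex; exists d.
exact: cvg_lim lim_d.
Qed.

Lemma rder_approx P t d :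
  (forall e : R, 0 < e -> exists2 r : R, 0 < r & forall s, `|s - t| < r ->
     normc (P s - P t - d * ((s - t)%:C)%C) <= e * `|s - t|) -> rder P t d.
Proof.
move=> H; split; apply: is_derive_approx => e e0; have [r r0 Hr] := H e e0;
  exists r => // s sr; apply: le_trans (Hr _ sr).
- apply: le_trans (normRe_le _); rewrite le_eqVlt; apply/predU1P; left; congr `|_|.
  by clear; case: (P s) (P t) d => [a b] [u v] [x y] /=; ring.
- apply: le_trans (normIm_le _); rewrite le_eqVlt; apply/predU1P; left; congr `|_|.
  by clear; case: (P s) (P t) d => [a b] [u v] [x y] /=; ring.
Qed.

Lemma cder_rder f d z c (t : R) : cder f (z + (t%:C)%C * c) d ->
  rder (fun s => f (z + (s%:C)%C * c)) t (d * c).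
Proof.
move=> /cder_approx H; apply: rder_approx => e e0.
have c0 : 0 < normc c + 1 by rewrite ltr_wpDl ?normc_ge0.
have [r r0 Hr] := H _ (divr_gt0 e0 c0).
exists (r / (normc c + 1)); first by rewrite divr_gt0.
move=> s st; set w := z + (s%:C)%C * c; set w0 := z + (t%:C)%C * c.
have E : w - w0 = ((s - t)%:C)%C * c by rewrite /w /w0 raddfB /=; ring.
have nE : normc (w - w0) = `|s - t| * normc c by rewrite E normcME normc_real.
have le1 : normc (w - w0) <= `|s - t| * (normc c + 1).
  by rewrite nE ler_wpM2l // lerDl.
have wr : normc (w - w0) < r by apply: le_lt_trans le1 _; rewrite -ltr_pdivlMr.
rewrite (_ : d * c * _ = d * (w - w0)); last by rewrite E; ring.
apply: (le_trans (Hr _ wr)).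
apply: (@le_trans _ _ (e / (normc c + 1) * (`|s - t| * (normc c + 1)))).
  by rewrite ler_wpM2l // divr_ge0 ?ltW.
rewrite le_eqVlt; apply/predU1P; left.
by field; rewrite gt_eqF.
Qed.

Lemma rderD P Q t c d : rder P t c -> rder Q t d -> rder (fun s => P s + Q s) t (c + d).
Proof.
move=> [p1 p2] [q1 q2]; split; rewrite raddfD.
- rewrite (_ : (fun s => _) = (fun s => complex.Re (P s)) + (fun s => complex.Re (Q s)));
    first exact: is_deriveD.
  by apply/funext => s; rewrite fctE raddfD.
- rewrite (_ : (fun s => _) = (fun s => complex.Im (P s)) + (fun s => complex.Im (Q s)));
    first exact: is_deriveD.
  by apply/funext => s; rewrite fctE raddfD.
Qed.

(** The real mean value theorem for the scalar product of [P] with [w = P b - P a], followed by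
    Cauchy-Schwarz. A point is produced, not just a bound, because [edge_disc] applies Bloch's
    theorem at that point. *)
Lemma mvt_exists P D (a b : R) : a < b -> (forall t, a <= t <= b -> rder P t (D t)) ->
  exists2 t, a <= t <= b & normc (P b - P a) <= normc (D t) * (b - a).
Proof.
move=> ab H; set w := P b - P a.
pose g t := complex.Re w * complex.Re (P t) + complex.Im w * complex.Im (P t).
pose g' t := complex.Re w * complex.Re (D t) + complex.Im w * complex.Im (D t).
have dg t : a <= t <= b -> is_derive t (1 : R) g (g' t).
  move=> /H[d1 d2]; rewrite /g /g'.
  exact: (is_deriveD (is_deriveZ _ d1) (is_deriveZ _ d2)).
have [||t tab E] := @MVT_segment R g g' a b (ltW ab).
- by move=> t; rewrite in_itv /= => /andP[h1 h2]; apply: dg; rewrite !ltW.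
- apply: derivable_within_continuous => t; rewrite in_itv /= => tab.
  by have := dg t tab => -[].
rewrite in_itv /= in tab; exists t => //.
have gE : g b - g a = normc w ^+ 2.
  rewrite /g [in RHS](complex_eta w) sqr_normc_def /w.
  by clear; case: (P b) (P a) => [u v] [x y] /=; ring.
have g'le : g' t <= normc w * normc (D t) by exact: normc_dot_le.
have [->|w0] := eqVneq w 0.
  by rewrite normc0E mulr_ge0 ?normc_ge0 ?subr_ge0 ?ltW.
have nw : 0 < normc w by rewrite normc_gt0.
rewrite -(ler_pM2l nw) -expr2 -gE E [leRHS]mulrA.
by rewrite ler_wpM2r // subr_ge0 ltW.
Qed.

Lemma mvt_bound P D (a b M : R) : a <= b -> (forall t, a <= t <= b -> rder P t (D t)) ->
  (forall t, a <= t <= b -> normc (D t) <= M) -> normc (P b - P a) <= M * (b - a).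
Proof.
rewrite le_eqVlt => /predU1P[->|ab H HM]; first by rewrite !subrr normc0E mulr0.
have [t tab] := mvt_exists ab H; move=> /le_trans; apply.
by apply: ler_wpM2r; [rewrite subr_ge0 ltW|exact: HM].
Qed.

Lemma segment_mvt f f' z w : (forall t : R, 0 <= t <= 1 ->
    cder f (z + (t%:C)%C * (w - z)) (f' (z + (t%:C)%C * (w - z)))) ->
  exists2 t : R, 0 <= t <= 1 &
    normc (f w - f z) <= normc (f' (z + (t%:C)%C * (w - z))) * normc (w - z).
Proof.
move=> H.
have [t t01] := @mvt_exists (fun s => f (z + (s%:C)%C * (w - z)))
  (fun t => f' (z + (t%:C)%C * (w - z)) * (w - z)) 0 1 ltr01 (fun t h => cder_rder (H t h)).
rewrite mul0r addr0 mul1r [z + _]addrC subrK subr0 mulr1 normcME => h.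
by exists t.
Qed.

(** The integral starts at [a'] and not at [a], near which [g] may be unbounded. *)
Lemma antiderivative (g : R -> R) (a a' : R) : a < a' ->
  (forall x, a < x -> {for x, continuous g}) ->
  exists G : R -> R, forall x, a' < x -> is_derive x (1 : R) G (g x).
Proof.
move=> aa' gc; exists (fun x => (\int[lebesgue_measure]_(t in `[a', x]) g t)%R) => x a'x.
have xx1 : x < x + 1 by rewrite ltrDl.
have ig : lebesgue_measure.-integrable `[a', x + 1] (EFin \o g).
  apply: continuous_compact_integrable; first exact: segment_compact.
  apply: continuous_in_subspaceT => y; rewrite inE /= in_itv /= => /andP[a'y _].
  by apply: gc; apply: lt_le_trans a'y.
have [d1 d2] := continuous_FTC1_closed xx1 ig a'x (gc _ (lt_trans aa' a'x)).
by apply: DeriveDef; [exact: d1|rewrite -derive1E; exact: d2].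
Qed.

End Derivatives.

(** * Goursat's lemma *)

Section Goursat.
Variable R : realType.
Implicit Types (z c d : R[i]) (f : R[i] -> R[i]).

Lemma mvt_bound_dist (P D : R -> R[i]) (a b M : R) :
  (forall t, `|t - a| <= `|b - a| -> rder P t (D t)) ->
  (forall t, `|t - a| <= `|b - a| -> normc (D t) <= M) ->
  normc (P b - P a) <= M * `|b - a|.
Proof.
move=> H HM; have [ab|ba] := leP a b.
  rewrite [X in _ * X]ger0_norm ?subr_ge0 //.
  by apply: (mvt_bound ab (D := D)) => t /andP[at_ tb];
    [apply: H|apply: HM]; rewrite !ger0_norm ?subr_ge0 // lerD2r.
rewrite [X in _ * X]ltr0_norm ?subr_lt0 // opprB normc_distC.
by apply: (mvt_bound (ltW ba) (D := D)) => t /andP[bt ta];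
  [apply: H|apply: HM]; rewrite !ler0_norm ?subr_le0 ?(ltW ba) // lerN2 lerD2r.
Qed.

Lemma antiderivative_complex (u : R -> R[i]) (a a' : R) : a < a' ->
  (forall x, a < x -> forall e : R, 0 < e -> exists2 d : R, 0 < d &
     forall s, `|s - x| < d -> normc (u s - u x) < e) ->
  exists P, forall x, a' < x -> rder P x (u x).
Proof.
move=> aa' uc.
have [|U HU] := @antiderivative R (fun x => complex.Re (u x)) a a' aa'.
  move=> x ax; apply/cvgrPdist_lt => e e0; have [d d0 Hd] := uc x ax e e0.
  apply/nbhs_ballP; exists d => // s; rewrite /ball /= distrC => sx.
  rewrite distrC -raddfB; exact: le_lt_trans (normRe_le _) (Hd _ sx).
have [|V HV] := @antiderivative R (fun x => complex.Im (u x)) a a' aa'.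
  move=> x ax; apply/cvgrPdist_lt => e e0; have [d d0 Hd] := uc x ax e e0.
  apply/nbhs_ballP; exists d => // s; rewrite /ball /= distrC => sx.
  rewrite distrC -raddfB; exact: le_lt_trans (normIm_le _) (Hd _ sx).
by exists (fun x => Complex (U x) (V x)) => x ax; split; [exact: HU|exact: HV].
Qed.

Lemma complex_horizontal (x y : R) :
  Complex x y = Complex 0 y + (x%:C)%C * 1 :> R[i].
Proof. by rewrite mulr1; apply: complex_ext => /=; ring. Qed.

Lemma complex_vertical (x y : R) :
  Complex x y = (x%:C)%C + (y%:C)%C * 'i%C :> R[i].
Proof. by apply: complex_ext => /=; ring. Qed.

Lemma cder_rder_horizontal f d (x y : R) : cder f (Complex x y) d ->
  rder (fun t => f (Complex t y)) x d.
Proof.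
rewrite complex_horizontal => /cder_rder; rewrite mulr1.
by under eq_fun do rewrite -complex_horizontal.
Qed.

Lemma cder_rder_vertical f d (x y : R) : cder f (Complex x y) d ->
  rder (fun t => f (Complex x t)) y (d * 'i%C).
Proof.
rewrite complex_vertical => /cder_rder.
by under eq_fun do rewrite -complex_vertical.
Qed.

Section RectangleIntegral.
Variables (f : R[i] -> R[i]) (a b : R).
Variables (P Q : R -> R -> R[i]).
Hypothesis df : forall z, a < complex.Re z -> b < complex.Im z -> exists d, cder f z d.
Hypothesis dP : forall x y, a < x -> b < y -> rder (P y) x (f (Complex x y)).
Hypothesis dQ : forall x y, a < x -> b < y -> rder (Q x) y (f (Complex x y) * 'i%C).

(** The integral of [f] counterclockwise around a rectangle, each side being the increment of a
    primitive along a horizontal or vertical line. *)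
Let W x1 x2 y1 y2 := (P y1 x2 - P y1 x1) - (P y2 x2 - P y2 x1)
  + (Q x2 y2 - Q x2 y1) - (Q x1 y2 - Q x1 y1).

(** The bound [e (w + h)^2] is preserved when four quarters are put together. On a small rectangle
    [f] differs from an affine map by at most [e / 2 * (w + h)], and the perimeter is
    [2 (w + h)]. *)
Lemma rectangle_integral_le (e x y w h : R) : 0 < e -> 0 <= w -> 0 <= h ->
  a < x -> b < y -> normc (W x (x + w) y (y + h)) <= e * (w + h) ^+ 2.
Proof.
move=> e0 w0 h0 ax0 by0.
pose S x y w h := a < x -> b < y -> normc (W x (x + w) y (y + h)) <= e * (w + h) ^+ 2.
suff : S x y w h by apply.
apply: rectangle_bisection => //.
- move=> {ax0}x {by0}y {w0}w {h0}h w0 h0 H1 H2 H3 H4 ax b_y.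
  have ax' : a < x + w / 2 by rewrite (lt_le_trans ax) // lerDl divr_ge0.
  have by' : b < y + h / 2 by rewrite (lt_le_trans b_y) // lerDl divr_ge0.
  have dbl (u v : R) : u + v / 2 + v / 2 = u + v by field.
  move: (H1 ax b_y) (H2 ax' b_y) (H3 ax by') (H4 ax' by'); rewrite !dbl.
  have -> : W x (x + w) y (y + h) =
     W x (x + w / 2) y (y + h / 2) + W (x + w / 2) (x + w) y (y + h / 2)
     + (W x (x + w / 2) (y + h / 2) (y + h) + W (x + w / 2) (x + w) (y + h / 2) (y + h)).
    by rewrite /W; ring.
  move=> k1 k2 k3 k4; rewrite (le_trans (normcD_le _ _)) //.
  rewrite (le_trans (lerD (normcD_le _ _) (normcD_le _ _))) //.
  rewrite (le_trans (lerD (lerD k1 k2) (lerD k3 k4))) //.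
  by rewrite le_eqVlt; apply/predU1P; left; field.
move=> p q /andP[xp _] /andP[yq _].
have ap : a < p by exact: lt_le_trans ax0 xp.
have bq : b < q by exact: lt_le_trans by0 yq.
have [d /cder_approx Hd] := df (z := Complex p q) ap bq.
have e20 : 0 < e / 2 by rewrite divr_gt0.
have [r r0 Hr] := Hd _ e20; set z := Complex p q in Hr.
exists (r / 2); first by rewrite divr_gt0.
move=> {w0 h0 ax0 by0 xp yq}x {}y {}w {}h /andP[xp pw] /andP[yq qh] wr hr ax by0.
have w0 : 0 <= w by rewrite -(lerD2l x) addr0 (le_trans xp).
have h0 : 0 <= h by rewrite -(lerD2l y) addr0 (le_trans yq).
(* A primitive of the affine approximation of [f] at [z]; its increments around a rectangle
   cancel. *)
pose F0 v := (f z - d * z) * v + d / 2 * (v * v).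
have dF0 v : cder F0 v (f z + d * (v - z)).
  apply: cder_eq (cderD (cderZ _ (cder_id v)) (cderZ _ (cderM (cder_id v) (cder_id v)))) _.
  by field.
pose E := e / 2 * (w + h).
have small x' y' : x <= x' <= x + w -> y <= y' <= y + h ->
    normc (f (Complex x' y') - (f z + d * (Complex x' y' - z))) <= E.
  move=> /andP[h1 h2] /andP[h3 h4].
  have dist : normc (Complex x' y' - z) <= w + h.
    rewrite (le_trans (normc_le_ReIm _)) //= lerD //.
      by rewrite ler_norml; apply/andP; split; lra.
    by rewrite ler_norml; apply/andP; split; lra.
  rewrite opprD addrA; apply: le_trans (Hr _ _) _; first by lra.
  by rewrite /E ler_wpM2l // ltW.
have hor y' : y <= y' <= y + h -> normc ((P y' (x + w) - P y' x)
    - (F0 (Complex (x + w) y') - F0 (Complex x y'))) <= E * w.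
  move=> yy; have b_y' : b < y' by case/andP: yy => ? _; exact: lt_le_trans by0 _.
  have -> : (P y' (x + w) - P y' x) - (F0 (Complex (x + w) y') - F0 (Complex x y')) =
    (P y' (x + w) - F0 (Complex (x + w) y')) - (P y' x - F0 (Complex x y')) by ring.
  rewrite [X in E * X](_ : w = x + w - x); last by ring.
  apply: (@mvt_bound _ (fun t => P y' t - F0 (Complex t y'))
    (fun t => f (Complex t y') - (f z + d * (Complex t y' - z)))).
  - by rewrite lerDl.
  - move=> t /andP[xt tx]; apply: rderD; first by apply: dP => //; exact: lt_le_trans ax xt.
    exact: (@cder_rder_horizontal (fun v => - F0 v)) (cderN (dF0 _)).
  - by move=> t xt; exact: small.
have ver x' : x <= x' <= x + w -> normc ((Q x' (y + h) - Q x' y)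
    - (F0 (Complex x' (y + h)) - F0 (Complex x' y))) <= E * h.
  move=> xx; have a_x' : a < x' by case/andP: xx => ? _; exact: lt_le_trans ax _.
  have -> : (Q x' (y + h) - Q x' y) - (F0 (Complex x' (y + h)) - F0 (Complex x' y)) =
    (Q x' (y + h) - F0 (Complex x' (y + h))) - (Q x' y - F0 (Complex x' y)) by ring.
  rewrite [X in E * X](_ : h = y + h - y); last by ring.
  apply: (@mvt_bound _ (fun t => Q x' t - F0 (Complex x' t))
    (fun t => (f (Complex x' t) - (f z + d * (Complex x' t - z))) * 'i%C)).
  - by rewrite lerDl.
  - move=> t /andP[yt ty]; rewrite mulrBl -mulNr; apply: rderD.
      by apply: dQ => //; exact: lt_le_trans by0 yt.
    exact: (@cder_rder_vertical (fun v => - F0 v)) (cderN (dF0 _)).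
  - by move=> t yt; rewrite normcME normc_i mulr1; exact: small.
have k1 := hor y; have k2 := hor (y + h); have k3 := ver x; have k4 := ver (x + w).
rewrite !lexx !lerDl w0 h0 in k1 k2 k3 k4.
have -> : W x (x + w) y (y + h) =
  ((P y (x + w) - P y x) - (F0 (Complex (x + w) y) - F0 (Complex x y))
   - ((P (y + h) (x + w) - P (y + h) x)
    - (F0 (Complex (x + w) (y + h)) - F0 (Complex x (y + h)))))
  + ((Q (x + w) (y + h) - Q (x + w) y)
    - (F0 (Complex (x + w) (y + h)) - F0 (Complex (x + w) y))
   - ((Q x (y + h) - Q x y) - (F0 (Complex x (y + h)) - F0 (Complex x y)))).
  by rewrite /W; ring.
rewrite (le_trans (normcD_le _ _)) //.
rewrite (le_trans (lerD (normcB_le _ _) (normcB_le _ _))) //.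
rewrite (le_trans (lerD (lerD (k1 _) (k2 _)) (lerD (k4 _) (k3 _)))) //.
by rewrite le_eqVlt; apply/predU1P; left; rewrite /E; field.
Qed.

Lemma rectangle_integral0 x1 x2 y1 y2 : a < x1 -> a < x2 -> b < y1 -> b < y2 ->
  W x1 x2 y1 y2 = 0.
Proof.
wlog x12 : x1 x2 / x1 <= x2.
  move=> H ax1 ax2 by1 by2; have [|/ltW] := leP x1 x2 => x12; first exact: H.
  have := H x2 x1 x12 ax2 ax1 by1 by2; rewrite /W => h.
  by apply/eqP; rewrite -oppr_eq0; apply/eqP; rewrite -[RHS]h; ring.
wlog y12 : y1 y2 / y1 <= y2.
  move=> H ax1 ax2 by1 by2; have [|/ltW] := leP y1 y2 => y12; first exact: H.
  have := H y2 y1 y12 ax1 ax2 by2 by1; rewrite /W => h.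
  by apply/eqP; rewrite -oppr_eq0; apply/eqP; rewrite -[RHS]h; ring.
move=> ax1 ax2 by1 by2.
apply/eqP; rewrite -normc_eq0 eq_le normc_ge0 andbT; apply/ler_addgt0Pl => e e0.
rewrite addr0; pose l := (x2 - x1) + (y2 - y1).
have l0 : 0 <= l by rewrite addr_ge0 ?subr_ge0.
have l1 : 0 < l ^+ 2 + 1 by rewrite ltr_wpDl ?sqr_ge0.
have := @rectangle_integral_le (e / (l ^+ 2 + 1)) x1 y1 (x2 - x1) (y2 - y1).
rewrite [x1 + _]addrC [y1 + _]addrC !subrK divr_gt0 // !subr_ge0 => /(_ isT x12 y12 ax1 by1) h.
apply: (le_trans h); rewrite -/l.
by rewrite -mulrA ler_piMr ?(ltW e0) // mulrC ler_pdivrMr // mul1r lerDl.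
Qed.

End RectangleIntegral.

(** [F z] integrates [f] from a base point with coordinates [p], [q], first vertically and then
    horizontally to [z]. The smaller quadrant leaves room for the primitives along lines, which
    start on its sides. *)
Theorem quadrant_primitive f (a b a' b' : R) : a < a' -> b < b' ->
  (forall z, a < complex.Re z -> b < complex.Im z -> exists d, cder f z d) ->
  exists F, forall z, a' < complex.Re z -> b' < complex.Im z -> cder F z (f z).
Proof.
move=> aa' bb' df.
have fc z : a < complex.Re z -> b < complex.Im z -> ccont f z.
  by move=> h1 h2; have [d /cder_cont] := df z h1 h2.
have exP (y : R) : exists G : R -> R[i], b < y ->
    forall x, a' < x -> rder G x (f (Complex x y)).
  have [b_y|] := ltP b y; last first.
    by exists (fun=> 0).
  have [|G HG] := @antiderivative_complex (fun x => f (Complex x y)) a a' aa'.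
    move=> x ax e e0; have /ccontP/(_ e e0)[d d0 Hd] := fc (Complex x y) ax b_y.
    exists d => // s sx; apply: Hd.
    rewrite (_ : _ - _ = ((s - x)%:C)%C) ?normc_real //.
    by apply: complex_ext => /=; ring.
  by exists G => _.
have exQ (x : R) : exists G : R -> R[i], a < x ->
    forall y, b' < y -> rder G y (f (Complex x y) * 'i%C).
  have [ax|] := ltP a x; last first.
    by exists (fun=> 0).
  have [|G HG] := @antiderivative_complex (fun y => f (Complex x y) * 'i%C) b b' bb'.
    move=> y b_y e e0; have /ccontP/(_ e e0)[d d0 Hd] := fc (Complex x y) ax b_y.
    exists d => // s sx; rewrite -mulrBl normcME normc_i mulr1; apply: Hd.
    rewrite (_ : _ - _ = ((s - y)%:C)%C * 'i%C).
      by rewrite normcME normc_i mulr1 normc_real.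
    by apply: complex_ext => /=; ring.
  by exists G => _.
have [P dP] := choice exP; have [Q dQ] := choice exQ.
pose p := a' + 1; pose q := b' + 1.
pose F z := P (complex.Im z) (complex.Re z) - P (complex.Im z) p
  + (Q p (complex.Im z) - Q p q).
exists F => -[x1 y1] /= ax1 by1; apply/cder_approx => e e0.
have e20 : 0 < e / 2 by rewrite divr_gt0.
have /ccontP/(_ _ e20)[r r0 Hr] := fc (Complex x1 y1) (lt_trans aa' ax1) (lt_trans bb' by1).
pose rr := Num.min (Num.min (r / 2) (x1 - a')) (y1 - b').
have rr0 : 0 < rr by rewrite !lt_min divr_gt0 //= !subr_gt0 ax1 by1.
exists rr => // -[x2 y2].
set z1 := Complex x1 y1; set z2 := Complex x2 y2.
rewrite !lt_min => /andP[/andP[zr zx] zy].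
have dx : `|x2 - x1| <= normc (z2 - z1) by exact: (normRe_le (z2 - z1)).
have dy : `|y2 - y1| <= normc (z2 - z1) by exact: (normIm_le (z2 - z1)).
have ax t : `|t - x1| <= `|x2 - x1| -> a' < t.
  move=> tx; have : `|t - x1| < x1 - a' by apply: le_lt_trans tx (le_lt_trans dx zx).
  by rewrite ltr_norml => /andP[]; lra.
have by_ t : `|t - y1| <= `|y2 - y1| -> b' < t.
  move=> ty; have : `|t - y1| < y1 - b' by apply: le_lt_trans ty (le_lt_trans dy zy).
  by rewrite ltr_norml => /andP[]; lra.
have by2 := by_ y2 (lexx _).
have W0 := @rectangle_integral0 f a' b' P Q
  (fun z h1 h2 => df z (lt_trans aa' h1) (lt_trans bb' h2))
  (fun x y h1 h2 => dP y (lt_trans bb' h2) x h1)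
  (fun x y h1 h2 => dQ x (lt_trans aa' h1) y h2) p x1 y1 y2.
have pa : a' < p by rewrite /p ltrDl.
have {}W0 := W0 pa ax1 by1 by2.
(* [W0] moves the vertical part of the path from the line through [p] to the line through [x1]. What
   remains is a short path from [z1] to [z2], on which [f] is nearly [f z1]. *)
have -> : F z2 - F z1 - f z1 * (z2 - z1) =
   (P y2 x2 - P y2 x1 - f z1 * ((x2 - x1)%:C)%C) +
   (Q x1 y2 - Q x1 y1 - f z1 * 'i%C * ((y2 - y1)%:C)%C).
  rewrite (_ : z2 - z1 = ((x2 - x1)%:C)%C + ((y2 - y1)%:C)%C * 'i%C); last first.
    by apply: complex_ext => /=; ring.
  by rewrite /F /= -[LHS]addr0 -W0; ring.
have fle x' y' : `|x' - x1| <= `|x2 - x1| -> `|y' - y1| <= `|y2 - y1| ->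
    normc (f (Complex x' y') - f z1) <= e / 2.
  move=> h1 h2; apply/ltW/Hr; apply: (le_lt_trans (normc_le_ReIm _)) => /=.
  by move: (le_lt_trans dx zr) (le_lt_trans dy zr); lra.
have k1 : normc (P y2 x2 - P y2 x1 - f z1 * ((x2 - x1)%:C)%C) <= e / 2 * `|x2 - x1|.
  have -> : P y2 x2 - P y2 x1 - f z1 * ((x2 - x1)%:C)%C =
    (P y2 x2 - f z1 * Complex x2 y2) - (P y2 x1 - f z1 * Complex x1 y2).
    rewrite [((x2 - x1)%:C)%C](_ : _ = Complex x2 y2 - Complex x1 y2); first by ring.
    by apply: complex_ext => /=; ring.
  apply: (@mvt_bound_dist (fun t => P y2 t - f z1 * Complex t y2)
    (fun t => f (Complex t y2) - f z1)) => t tx; last by exact: fle.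
  apply: rderD; first by apply: dP; [exact: lt_trans by2|exact: ax].
  apply: (@cder_rder_horizontal (fun v => - (f z1 * v))).
  by apply: cder_eq (cderN (cderZ _ (cder_id _))) _; rewrite mulr1.
have k2 : normc (Q x1 y2 - Q x1 y1 - f z1 * 'i%C * ((y2 - y1)%:C)%C) <= e / 2 * `|y2 - y1|.
  have -> : Q x1 y2 - Q x1 y1 - f z1 * 'i%C * ((y2 - y1)%:C)%C =
    (Q x1 y2 - f z1 * Complex x1 y2) - (Q x1 y1 - f z1 * Complex x1 y1).
    have E : 'i%C * ((y2 - y1)%:C)%C = Complex x1 y2 - Complex x1 y1 :> R[i].
      by apply: complex_ext => /=; ring.
    by rewrite -mulrA E; ring.
  apply: (@mvt_bound_dist (fun t => Q x1 t - f z1 * Complex x1 t)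
    (fun t => (f (Complex x1 t) - f z1) * 'i%C)) => t ty; last first.
    by rewrite normcME normc_i mulr1; apply: fle => //; rewrite subrr normr0.
  rewrite mulrBl -mulNr; apply: rderD; first by apply: dQ; [exact: lt_trans ax1|exact: by_].
  apply: (@cder_rder_vertical (fun v => - (f z1 * v))).
  by apply: cder_eq (cderN (cderZ _ (cder_id _))) _; rewrite mulr1.
apply: (le_trans (normcD_le _ _)); apply: (le_trans (lerD k1 k2)).
by rewrite -mulrDr -mulrA ler_wpM2l ?(ltW e0) //; lra.
Qed.

End Goursat.

(** * Cauchy's estimate *)

Section ComplexExp.
Variable R : realType.
Implicit Types (z w d : R[i]).

Definition cexp z : R[i] :=
  Complex (expR (complex.Re z) * cos (complex.Im z)) (expR (complex.Re z) * sin (complex.Im z)).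

Lemma cexpD z w : cexp (z + w) = cexp z * cexp w.
Proof.
case: z w => [a b] [c d]; apply: complex_ext => /=; rewrite expRD ?cosD ?sinD; ring.
Qed.

Lemma cexp0 : cexp 0 = 1.
Proof. by rewrite /cexp /= expR0 cos0 sin0 mul1r mulr0. Qed.

Lemma cexp_neq0 z : cexp z != 0.
Proof.
apply/eqP => z0; have := cexpD z (- z).
rewrite subrr cexp0 z0 mul0r => /eqP; by rewrite oner_eq0.
Qed.

Lemma normc_cexp z : normc (cexp z) = expR (complex.Re z).
Proof.
rewrite /cexp /= !exprMn -mulrDr cos2Dsin2 mulr1 sqrtr_sqr.
by rewrite ger0_norm ?expR_ge0.
Qed.

Lemma cexp_period z : cexp (z + Complex 0 (2 * pi)) = cexp z.
Proof.
rewrite cexpD [X in _ * X](_ : _ = 1) ?mulr1 // /cexp /= expR0 !mul1r.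
by rewrite mulr_natl cos2pi sin2pi.
Qed.

Lemma is_derive_approx_inv (g : R -> R) (t d : R) : is_derive t (1 : R) g d ->
  forall e : R, 0 < e -> exists2 r : R, 0 < r & forall s, `|s - t| < r ->
     `|g s - g t - d * (s - t)| <= e * `|s - t|.
Proof.
move=> [dg dgE] e e0.
have : (fun h : R => h^-1 *: (g (h *: (1 : R) + t) - g t)) @ 0^' --> d.
  by rewrite -dgE; exact: dg.
move=> /cvgrPdist_le/(_ e e0)/nbhs_ballP[r /= r0 Hr]; exists r => // s sr.
have [->|st] := eqVneq s t; first by rewrite !subrr mulr0 subrr normr0 mulr0.
have := Hr (s - t); rewrite /ball /= sub0r normrN => /(_ sr).
rewrite subr_eq0 => /(_ st); rewrite -[_ *: 1]/(_ * _) mulr1 subrK.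
rewrite -[_ *: _]/(_ * _) => h.
have -> : g s - g t - d * (s - t) = - ((d - (s - t)^-1 * (g s - g t)) * (s - t)).
  by field; rewrite subr_eq0.
by rewrite normrN normrM ler_wpM2r.
Qed.

Lemma cder_cexp0 : cder cexp 0 1.
Proof.
apply/cder_approx => e e0.
(* The four error terms below add up to [(2 + 1 + 2 + 1) k n]. *)
have e60 : 0 < Num.min (e / 6) 1 by rewrite lt_min divr_gt0 /= ?ltr01.
set k := Num.min (e / 6) 1 in e60.
have ke : k <= e / 6 by rewrite ge_min lexx.
have k1 : k <= 1 by rewrite ge_min lexx orbT.
have [r1 r10 H1] := is_derive_approx_inv (is_derive_expR (0 : R)) e60.
have [r2 r20 H2] := is_derive_approx_inv (is_derive_cos (0 : R)) e60.
have [r3 r30 H3] := is_derive_approx_inv (is_derive_sin (0 : R)) e60.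
pose r := Num.min (Num.min r1 r2) (Num.min r3 (k / 2)).
exists r; first by rewrite !lt_min r10 r20 r30 divr_gt0.
move=> [x y]; rewrite subr0 cexp0 mul1r !lt_min => /andP[/andP[zr1 zr2] /andP[zr3 zr4]].
set n := normc _ in zr1 zr2 zr3 zr4 *.
have xn : `|x| <= n by exact: (normRe_le (Complex x y)).
have yn : `|y| <= n by exact: (normIm_le (Complex x y)).
have := H1 x; rewrite subr0 expR0 mul1r => /(_ (le_lt_trans xn zr1)) h1.
have := H2 y; rewrite subr0 cos0 sin0 oppr0 mul0r subr0 => /(_ (le_lt_trans yn zr2)) h2.
have := H3 y; rewrite subr0 sin0 cos0 subr0 mul1r => /(_ (le_lt_trans yn zr3)) h3.
have n0 : 0 <= n by exact: normc_ge0.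
have kn : k * n <= n by rewrite ler_piMl // ltW.
have h1' : `|expR x - 1| <= k.
  have -> : expR x - 1 = (expR x - 1 - x) + x by ring.
  rewrite (le_trans (ler_normD _ _)) // (le_trans (lerD h1 xn)) //.
  have : k * `|x| <= n by rewrite (le_trans _ kn) // ler_wpM2l // ltW.
  by lra.
have h4 : expR x <= 2 by move: h1'; rewrite ler_norml => /andP[]; lra.
have hk u : u <= n -> k * u <= k * n by move=> un; rewrite ler_wpM2l // ltW.
have -> : cexp (Complex x y) - 1 - Complex x y =
    Complex (expR x * (cos y - 1) + (expR x - 1 - x))
            (expR x * (sin y - y) + (expR x - 1) * y).
  by apply: complex_ext => /=; ring.
apply: (le_trans (normc_le_ReIm _)) => /=.
have b1 : `|expR x * (cos y - 1)| <= 2 * (k * n).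
  rewrite normrM ger0_norm ?expR_ge0 // ler_pM ?expR_ge0 //.
  exact: le_trans h2 (hk _ yn).
have b2 : `|expR x * (sin y - y)| <= 2 * (k * n).
  rewrite normrM ger0_norm ?expR_ge0 // ler_pM ?expR_ge0 //.
  exact: le_trans h3 (hk _ yn).
have b3 : `|(expR x - 1) * y| <= k * n by rewrite normrM ler_pM.
have b4 : `|expR x - 1 - x| <= k * n by exact: le_trans h1 (hk _ xn).
have en : k * n <= e / 6 * n by rewrite ler_wpM2r.
apply: (le_trans (lerD (ler_normD _ _) (ler_normD _ _))).
apply: (le_trans (lerD (lerD b1 b4) (lerD b2 b3))); rewrite -/n.
by move: en; lra.
Qed.

Lemma cder_cexp z : cder cexp z (cexp z).
Proof.
have -> : cexp = (fun w => cexp z * cexp (w - z)).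
  by apply/funext => w; rewrite -cexpD addrC subrK.
rewrite [X in cder _ _ X](_ : _ = cexp z * (1 * (1 - 0))); last first.
  by rewrite subrr cexp0 subr0 !mulr1.
apply: cderZ; apply: (@cder_comp _ (fun w => w - z)).
  by apply: cderB; [exact: cder_id|exact: cder_cst].
by rewrite subrr; exact: cder_cexp0.
Qed.

End ComplexExp.

Section CauchyEstimate.
Variable R : realType.
Implicit Types (z w d : R[i]) (f : R[i] -> R[i]).

Definition hol_ball f z (r : R) := forall w, normc (w - z) < r -> exists d, cder f w d.

Lemma constant_of_rder0 (P : R -> R[i]) (a b : R) : a <= b ->
  (forall t, a <= t <= b -> rder P t 0) -> P a = P b.
Proof.
move=> ab H; apply/eqP; rewrite eq_sym -subr_eq0 -normc_eq0 eq_le normc_ge0 andbT.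
by rewrite -(mul0r (b - a)) (mvt_bound ab H) // => t _; rewrite normc0E.
Qed.

(* The difference quotient [q] of [f] at [z], composed with [zeta |-> s e^(i zeta)], has
period [2 pi] on a half plane, so that the increment of a primitive over a period does
not depend on [Im zeta]. At [Im zeta = 0] it is at most [2 pi M / s], and it tends to
[2 pi f'(z)] when [Im zeta] tends to infinity. *)
Lemma cauchy_estimate f z d (r M : R) : 0 < r -> hol_ball f z r -> cder f z d ->
  (forall w, normc (w - z) < r -> normc (f w - f z) <= M) -> normc d <= M / r.
Proof.
move=> r0 hf dfz fM.
have M0 : 0 <= M by have := fM z; rewrite !subrr normc0E; exact.
suff main s : 0 < s -> s < r -> normc d <= M / s.
  rewrite ler_pdivlMr //; apply/ler_addgt0Pl => e e0.
  have [|M_e] := leP (normc d * r) (e + M); first by [].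
  have dr : 0 < normc d * r by lra.
  have d0 : 0 < normc d by rewrite -(pmulr_lgt0 _ r0).
  have sr : (e / 2 + M) / normc d < r.
    by rewrite ltr_pdivrMr //; lra.
  have s0 : 0 < (e / 2 + M) / normc d by rewrite divr_gt0 // ltr_wpDr // divr_gt0.
  have := main _ s0 sr; rewrite ler_pdivlMr // mulrCA divff ?gt_eqF // mulr1.
  by rewrite gerDr => /le_lt_trans/(_ (_ : 0 < e / 2)); rewrite ltxx divr_gt0 // => /(_ isT).
move=> s0 sr.
pose e1 (v : R[i]) := (s%:C)%C * cexp ('i%C * v).
pose F v := (f (z + e1 v) - f z) / e1 v.
have e1_neq0 v : e1 v != 0.
  rewrite mulf_neq0 ?cexp_neq0 // -normc_eq0 normc_real gt_eqF //.
  by rewrite normr_gt0 gt_eqF.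
have e1_norm v : normc (e1 v) = s * expR (- complex.Im v).
  rewrite normcME normc_real gtr0_norm // normc_cexp.
  by case: v => x y /=; congr (_ * expR _); ring.
have de1 v : cder e1 v ((s%:C)%C * (cexp ('i%C * v) * ('i%C * 1))).
  apply: cderZ; apply: (@cder_comp _ (fun v => 'i%C * v) (@cexp R)).
    exact/cderZ/cder_id.
  exact: cder_cexp.
(* [|e1 v| = s exp (- Im v)] is below [r] exactly when [Im v > b]; as [b < 0], the closed upper half
   plane is covered. *)
pose b := ln (s / r).
have b0 : b < 0 by rewrite /b ln_lt0 // divr_gt0 //= ltr_pdivrMr // mul1r.
have small v : b < complex.Im v -> normc (e1 v) < r.
  move=> bv; rewrite e1_norm -(@ltr_pM2r _ (expR (complex.Im v))) ?expR_gt0 //.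
  rewrite -mulrA -expRD addNr expR0 mulr1.
  have : expR b < expR (complex.Im v) by rewrite ltr_expR.
  rewrite /b lnK ?posrE ?divr_gt0 // ltr_pdivrMr // mulrC.
  by rewrite [r * _]mulrC.
have dF v : -2 < complex.Re v -> b < complex.Im v -> exists d, cder F v d.
  move=> _ bv.
  have [c Hc] : exists c, cder f (z + e1 v) c.
    by apply: hf; rewrite addrC addKr small.
  have D1 : cder (fun v => f (z + e1 v) - f z) v
     (c * (0 + (s%:C)%C * (cexp ('i%C * v) * ('i%C * 1))) - 0).
    apply: cderB; last exact: cder_cst.
    by apply: (@cder_comp _ (fun v => z + e1 v)) => //; apply: cderD => //; exact: cder_cst.
  have D2 := cder_comp (de1 v) (cderV (e1_neq0 v)).
  by eexists; exact: cderM D1 D2.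
have b2 : b < b / 2 by lra.
(* The quadrant only has to contain the period segment from [0] to [2 pi]. *)
have lt21 : -2 < -1 :> R by lra.
have [G dG] := quadrant_primitive lt21 b2 dF.
have F_period x y : F (Complex (x + 2 * pi) y) = F (Complex x y).
  have -> : F (Complex (x + 2 * pi) y) = (f (z + e1 (Complex (x + 2 * pi) y)) - f z) /
    e1 (Complex (x + 2 * pi) y) by [].
  rewrite (_ : e1 (Complex (x + 2 * pi) y) = e1 (Complex x y)) // /e1; congr (_ * _).
  rewrite -[RHS]cexp_period; congr cexp.
  by apply: complex_ext => /=; ring.
have pi2 : 0 <= 2 * pi :> R by rewrite mulr_ge0 ?pi_ge0.
pose A y := G (Complex (2 * pi) y) - G (Complex 0 y).
(* The derivative of [A] is [i (F (2 pi + i t) - F (i t))], which vanishes by periodicity. *)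
have A_const y : 0 <= y -> A y = A 0.
  move=> y0; symmetry; apply: (constant_of_rder0 y0) => t /andP[t0 _].
  have tb : b / 2 < t by apply: lt_le_trans t0; lra.
  rewrite -(subrr (F (Complex 0 t) * 'i%C)) -mulNr.
  apply: rderD.
    by rewrite -F_period add0r; apply: cder_rder_vertical; apply: dG => //=; lra.
  apply: (@cder_rder_vertical _ (fun v => - G v)); apply: cderN.
  by apply: dG => //=; lra.
have A_near c y e : 0 <= y -> (forall x, normc (F (Complex x y) - c) <= e) ->
    normc (A y - c * ((2 * pi)%:C)%C) <= e * (2 * pi).
  move=> y0 He.
  have yb : b / 2 < y by apply: lt_le_trans y0; lra.
  have -> : A y - c * ((2 * pi)%:C)%C = (G (Complex (2 * pi) y) - c * Complex (2 * pi) y)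
      - (G (Complex 0 y) - c * Complex 0 y).
    rewrite (_ : ((2 * pi)%:C)%C = Complex (2 * pi) y - Complex 0 y); first by rewrite /A; ring.
    by apply: complex_ext => /=; ring.
  rewrite [X in _ <= _ * X](_ : _ = 2 * pi - 0); last by rewrite subr0.
  apply: (@mvt_bound _ (fun t => G (Complex t y) - c * Complex t y)
    (fun t => F (Complex t y) - c)) => // t /andP[t0 _].
  apply: (@cder_rder_horizontal _ (fun v => G v - c * v)).
  apply: cderB; first by apply: dG => //=; lra.
  by apply: cder_eq (cderZ _ (cder_id _)) _; rewrite mulr1.
have A0 : normc (A 0) <= M / s * (2 * pi).
  have := @A_near 0 0 (M / s) (lexx _); rewrite mul0r subr0; apply => x.
  rewrite subr0 /F normcME normcVE e1_norm /= oppr0 expR0 mulr1.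
  rewrite ler_wpM2r ?invr_ge0 ?(ltW s0) //; apply: fM.
  by rewrite addrC addKr e1_norm /= oppr0 expR0 mulr1.
have pi20 : 0 < 2 * pi :> R by rewrite mulr_gt0 ?pi_gt0.
rewrite -(ler_pM2r pi20); apply/ler_addgt0Pl => e e0.
have e10 : 0 < e / (2 * pi) by rewrite divr_gt0.
have /cder_approx/(_ _ e10)[t t0 Ht] := dfz.
(* [exp y >= 1 + y > s / t], so that [|e1| < t] at the height [y]. *)
pose y := s / t.
have y0 : 0 <= y by rewrite divr_ge0 ?ltW.
have st : s * expR (- y) < t.
  rewrite expRN ltr_pdivrMr ?expR_gt0 // -ltr_pdivrMl // mulrC.
  by apply: lt_le_trans (expR_ge1Dx y); rewrite ltrDr.
have near_d : normc (A y - d * ((2 * pi)%:C)%C) <= e.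
  rewrite -[leRHS](divfK (lt0r_neq0 pi20)); apply: A_near => // x.
  have := Ht (z + e1 (Complex x y)); rewrite [z + _]addrC addrK e1_norm => /(_ st) h.
  have e1p : 0 < normc (e1 (Complex x y)) by rewrite normc_gt0.
  rewrite -(ler_pM2r e1p) -normcME mulrBl divfK // [z + _]addrC.
  by rewrite e1_norm.
rewrite -[normc d * _](_ : normc (d * ((2 * pi)%:C)%C) = _); last first.
  by rewrite normcME normc_real ger0_norm.
rewrite (_ : d * _ = A y - (A y - d * ((2 * pi)%:C)%C)); last by ring.
by rewrite (le_trans (normcB_le _ _)) // [leRHS]addrC lerD // A_const.
Qed.

End CauchyEstimate.

(** * Bloch's theorem *)

Section Bloch.
Variable R : realType.
Implicit Types (z w d u v : R[i]) (f : R[i] -> R[i]).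

Definition cderiv f z : R[i] := xget 0 [set d | cder f z d].

Lemma cderivP f z : (exists d, cder f z d) -> cder f z (cderiv f z).
Proof. by move=> [d Hd]; rewrite /cderiv; case: xgetP => // /(_ d). Qed.

Lemma hol_ballS f z w r s : normc (w - z) + s <= r -> hol_ball f z r -> hol_ball f w s.
Proof.
move=> h hf u uw; apply: hf; apply: le_lt_trans (normc_dist_le w _ _) _.
by rewrite addrC; apply: lt_le_trans h; rewrite ltrD2l.
Qed.

Lemma normc_convex z u v r (t : R) : 0 <= t <= 1 -> normc (u - z) < r ->
  normc (v - z) < r -> normc (u + (t%:C)%C * (v - u) - z) < r.
Proof.
move=> /andP[t0 t1] ur vr.
have -> : u + (t%:C)%C * (v - u) - z = ((1 - t)%:C)%C * (u - z) + (t%:C)%C * (v - z).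
  by rewrite raddfB /=; ring.
apply: (le_lt_trans (normcD_le _ _)); rewrite !normcME !normc_real.
rewrite !ger0_norm ?subr_ge0 //.
have := normc_ge0 (u - z); have := normc_ge0 (v - z).
have [->|tpos] := eqVneq t 0; first by rewrite subr0 mul0r addr0 mul1r.
have {}tpos : 0 < t by rewrite lt_def tpos t0.
have k1 : (1 - t) * normc (u - z) <= (1 - t) * r by rewrite ler_wpM2l ?subr_ge0 // ltW.
have k2 : t * normc (v - z) < t * r by rewrite ltr_pM2l.
by lra.
Qed.

Lemma ball_mvt f z u v (r B : R) : hol_ball f z r ->
  (forall w, normc (w - z) < r -> normc (cderiv f w) <= B) ->
  normc (u - z) < r -> normc (v - z) < r -> normc (f v - f u) <= B * normc (v - u).
Proof.
move=> hf HB ur vr.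
have [|t t01 h] := @segment_mvt R f (cderiv f) u v.
  by move=> t t01; apply: cderivP; apply: hf; exact: normc_convex.
apply: (le_trans h); rewrite ler_wpM2r ?normc_ge0 // HB //; exact: normc_convex.
Qed.

(** Cauchy's estimate for [u |-> f (u + (w - z)) - f u]: its derivative at [z] is [f' w - f' z] and
    its size is at most [B |w - z|]. No second derivative is involved, so [deriv_holomorphic] can
    rely on this. *)
Lemma deriv_lipschitz f z w (r B : R) : 0 < r -> hol_ball f z (2 * r) ->
  (forall u, normc (u - z) < 2 * r -> normc (cderiv f u) <= B) ->
  normc (w - z) < r -> normc (cderiv f w - cderiv f z) <= 2 * B * normc (w - z) / r.
Proof.
move=> r0 hf HB wr.
have mid u : normc (u - z) < r -> normc (u + (w - z) - z) < 2 * r.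
  move=> ur; rewrite addrAC (le_lt_trans (normcD_le _ _)) //.
  by rewrite mulr_natl mulr2n ltrD.
have ur2 u : normc (u - z) < r -> normc (u - z) < 2 * r.
  by move=> ur; have := normc_ge0 (u - z); lra.
have dg u : normc (u - z) < r ->
    cder (fun u => f (u + (w - z)) - f u) u (cderiv f (u + (w - z)) - cderiv f u).
  move=> ur; apply: cderB; last by apply/cderivP/hf/ur2.
  have D : cder (fun u => u + (w - z)) u 1.
    by apply: cder_eq (cderD (cder_id _) (cder_cst _ _)) _; rewrite addr0.
  apply: cder_eq (cder_comp D _) _; last by rewrite mulr1.
  by apply/cderivP/hf/mid.
have bnd u : normc (u - z) < r -> normc (f (u + (w - z)) - f u) <= B * normc (w - z).
  move=> ur; have := ball_mvt hf HB (ur2 _ ur) (mid _ ur).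
  by rewrite [u + _ - _]addrAC subrr add0r.
have zz : normc (z - z) < r by rewrite subrr normc0E.
have := @cauchy_estimate R (fun u => f (u + (w - z)) - f u) z _ r (2 * B * normc (w - z)) r0 _ (dg z zz).
rewrite [z + (w - z)]addrC subrK; apply.
  by move=> u ur; eexists; exact: dg.
have bz : normc (f w - f z) <= B * normc (w - z).
  by have := bnd z zz; rewrite [z + (w - z)]addrC subrK.
move=> u ur; apply: (le_trans (normcB_le _ _)); apply: (le_trans (lerD (bnd u ur) bz)).
by rewrite le_eqVlt; apply/predU1P; left; ring.
Qed.

(** Continuity of [f] alone gives oscillation at most [2] near [z], which Cauchy's estimate on discs
    of radius [t] converts into [2 / t]. *)
Lemma deriv_locally_bounded f z (r : R) : 0 < r -> hol_ball f z r ->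
  exists s B : R, [/\ 0 < s, s <= r, 0 < B &
    forall u, normc (u - z) < s -> normc (cderiv f u) <= B].
Proof.
move=> r0 hf.
have [|d /cder_cont/ccontP/(_ 1 ltr01)[s s0 Hs]] := hf z; first by rewrite subrr normc0E.
pose t := Num.min s r / 2.
have m0 : 0 < Num.min s r by rewrite lt_min s0 r0.
have ms : Num.min s r <= s by rewrite ge_min lexx.
have mr : Num.min s r <= r by rewrite ge_min lexx orbT.
have t0 : 0 < t by rewrite divr_gt0.
exists t, (2 / t); split => //; [by rewrite /t; lra|by rewrite divr_gt0|].
move=> u ut.
have near w : normc (w - u) < t -> normc (w - z) < Num.min s r.
  move=> wu; apply: le_lt_trans (normc_dist_le u _ _) _.
  by rewrite (_ : Num.min s r = t + t) ?ltrD // /t; field.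
apply: (@cauchy_estimate R f u _ t 2 t0).
- by move=> w wu; apply: hf; exact: lt_le_trans (near _ wu) mr.
- apply/cderivP/hf; apply: lt_le_trans (near u _) mr.
  by rewrite subrr normc0E.
- move=> w wu; have -> : f w - f u = (f w - f z) - (f u - f z) by ring.
  rewrite (le_trans (normcB_le _ _)) // (_ : 2 = 1 + 1) // lerD // ltW // Hs //.
    exact: lt_le_trans (near _ wu) ms.
  by apply: lt_le_trans (near u _) ms; rewrite subrr normc0E.
Qed.

Lemma half_expn_small (a e : R) : 0 < e -> exists k, a / 2 ^+ k < e.
Proof.
move=> e0; exists (Num.truncn (`|a| / e)).+1.
rewrite ltr_pdivrMr ?exprn_gt0 // mulrC -ltr_pdivrMr //.
apply: le_lt_trans (_ : `|a| / e < _).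
  by rewrite ler_wpM2r ?ler_norm // invr_ge0 ltW.
apply: (lt_le_trans (truncnS_gt _)); rewrite -natrX ler_nat.
exact/ltnW/ltn_expl.
Qed.

(* The derivatives [(f'(z + h) - f'(z)) / h] at [z] of the difference quotients
[(f(. + h) - f(.)) / h] satisfy the Cauchy criterion, by [cauchy_estimate]. *)
Lemma deriv_holomorphic f z (r0 : R) : 0 < r0 -> hol_ball f z r0 ->
  exists d, cder (cderiv f) z d.
Proof.
move=> r00 hf0; have [r [B [r_gt0 rr0 B0 HB]]] := deriv_locally_bounded r00 hf0.
have hf : hol_ball f z r by move=> u ur; apply: hf0; exact: lt_le_trans ur rr0.
pose q := r / 4; have q0 : 0 < q by rewrite divr_gt0.
pose L := 2 * B / q.
have L0 : 0 < L by rewrite divr_gt0 // mulr_gt0.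
have lip u w : normc (u - z) < 2 * q -> normc (w - u) < q ->
    normc (cderiv f w - cderiv f u) <= L * normc (w - u).
  move=> uz wu; rewrite /L mulrAC.
  have in_r v : normc (v - u) < 2 * q -> normc (v - z) < r.
    move=> vu; apply: le_lt_trans (normc_dist_le u _ _) _.
    by rewrite (_ : r = 2 * q + 2 * q) ?ltrD // /q; field.
  apply: (deriv_lipschitz q0) => //.
  - by move=> v vu; apply: hf; exact: in_r.
  - by move=> v vu; apply: HB; exact: in_r.
have taylor u h : normc (u - z) < q -> normc h < q ->
    normc (f (u + h) - f u - cderiv f u * h) <= L * normc h * normc h.
  move=> uz hq.
  have pts (t : R) : 0 <= t <= 1 -> normc (u + (t%:C)%C * (u + h - u) - u) <= normc h.
    move=> /andP[t0 t1]; have -> : u + (t%:C)%C * (u + h - u) - u = (t%:C)%C * h by ring.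
    by rewrite normcME normc_real ger0_norm // ler_piMl ?normc_ge0.
  have [|t t01] := @segment_mvt R (fun v => f v - cderiv f u * v)
      (fun v => cderiv f v - cderiv f u) u (u + h).
    move=> t t01; apply: cderB; last by apply: cder_eq (cderZ _ (cder_id _)) _; rewrite mulr1.
    apply/cderivP/hf; apply: le_lt_trans (normc_dist_le u _ _) _.
    apply: (le_lt_trans (lerD (pts _ t01) (ltW uz))).
    by apply: (@lt_trans _ _ (q + q)); [rewrite ltrD2r|rewrite /q; lra].
  rewrite [X in normc X <= _](_ : _ = f (u + h) - f u - cderiv f u * h); last by ring.
  rewrite [u + h - u]addrAC subrr add0r => H; apply: (le_trans H).
  rewrite ler_wpM2r ?normc_ge0 //.
  have := pts _ t01; rewrite [u + h - u]addrAC subrr add0r => le_h.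
  apply: (le_trans (lip _ _ _ _)).
  - by have := normc_ge0 (u - z); lra.
  - exact: le_lt_trans hq.
  - by rewrite ler_wpM2l // ltW.
pose D h := (cderiv f (z + h) - cderiv f z) / h.
pose K := 2 * L / q.
have K0 : 0 < K by rewrite divr_gt0 // mulr_gt0.
have zq : normc (z - z) < q by rewrite subrr normc0E.
have cauchyD h k : h != 0 -> k != 0 -> normc h < q -> normc k < q ->
    normc (D h - D k) <= K * (normc h + normc k).
  move=> h0 k0 hq kq.
  (* The derivative of [g] at [z] is [D h - D k], and [taylor] makes [g] small because both
     quotients are close to [f' u]. *)
  pose g u := (f (u + h) - f u) / h - (f (u + k) - f u) / k.
  have dshift c u : normc c < q -> normc (u - z) < q ->
      cder (fun u => (f (u + c) - f u) / c) u ((cderiv f (u + c) - cderiv f u) / c).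
    move=> cq uz.
    have -> : (fun u => (f (u + c) - f u) / c) = (fun u => c^-1 * (f (u + c) - f u)).
      by apply/funext => v; rewrite mulrC.
    rewrite mulrC; apply: cderZ; apply: cderB; last first.
      by apply/cderivP/hf; rewrite /q in uz; have := normc_ge0 (u - z); lra.
    have S : cder (fun u => u + c) u 1.
      by apply: cder_eq (cderD (cder_id _) (cder_cst _ _)) _; rewrite addr0.
    apply: cder_eq (cder_comp S _) _; last by rewrite mulr1.
    apply/cderivP/hf; rewrite addrAC (le_lt_trans (normcD_le _ _)) //.
    by have := normc_ge0 c; have := normc_ge0 (u - z); rewrite /q in uz cq; lra.
  have dg u : normc (u - z) < q -> cder g u
      ((cderiv f (u + h) - cderiv f u) / h - (cderiv f (u + k) - cderiv f u) / k).
    by move=> uz; apply: cderB; exact: dshift.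
  have gle u : normc (u - z) < q -> normc (g u) <= L * (normc h + normc k).
    move=> uz.
    have one c : c != 0 -> normc c < q -> normc ((f (u + c) - f u) / c - cderiv f u) <= L * normc c.
      move=> c0 cq; have nc : 0 < normc c by rewrite normc_gt0.
      by rewrite -(ler_pM2r nc) -normcME mulrBl divfK //; exact: taylor.
    have -> : g u = ((f (u + h) - f u) / h - cderiv f u) - ((f (u + k) - f u) / k - cderiv f u).
      by rewrite /g; ring.
    rewrite (le_trans (normcB_le _ _)) // mulrDr lerD //; exact: one.
  have := @cauchy_estimate R g z _ q (2 * L * (normc h + normc k)) q0 _ (dg z zq).
  rewrite /K [2 * L / q * _]mulrAC; apply.
    by move=> u uz; eexists; exact: dg.
  move=> u uz; rewrite (le_trans (normcB_le _ _)) //.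
  by rewrite (le_trans (lerD (gle u uz) (gle z zq))) //; lra.
pose h k : R[i] := ((q / 2 / 2 ^+ k)%:C)%C.
have hn k : normc (h k) = q / 2 / 2 ^+ k.
  by rewrite normc_real ger0_norm // !divr_ge0 ?exprn_ge0 ?ltW.
have h0 k : h k != 0 by rewrite -normc_gt0 hn !divr_gt0 ?exprn_gt0.
have hhalf k : normc (h k) <= q / 2.
  rewrite hn ler_pdivrMr ?exprn_gt0 //; apply: ler_peMr; first by lra.
  by rewrite exprn_ege1 // ler1n.
have hq k : normc (h k) < q by apply: le_lt_trans (hhalf k) _; lra.
have [l Hl] : exists l, forall k, normc (D (h k) - l) <= 4 * (K * q) / 2 ^+ k.
  apply: geometric_limc => k; apply: (le_trans (cauchyD _ _ _ _ _ _)) => //.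
  rewrite -mulrA ler_wpM2l ?(ltW K0) // !hn exprS.
  have : 0 < 2 ^+ k :> R by rewrite exprn_gt0.
  move=> p0; rewrite [leLHS](_ : _ = 3 / 4 * (q / 2 ^+ k)); last first.
    by field; rewrite gt_eqF.
  by rewrite ler_piMl ?divr_ge0 ?(ltW q0) ?(ltW p0) //; lra.
exists l; apply/cder_approx => e e0.
exists (Num.min q (e / (2 * K))); first by rewrite lt_min q0 divr_gt0 // mulr_gt0.
move=> w; rewrite lt_min => /andP[wq we].
have [->|wz] := eqVneq w z; first by rewrite !subrr mulr0 subrr normc0E mulr0.
have wz0 : w - z != 0 by rewrite subr_eq0.
have nw : 0 < normc (w - z) by rewrite normc_gt0.
have -> : cderiv f w - cderiv f z - l * (w - z) = (D (w - z) - l) * (w - z).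
  by rewrite /D mulrBl divfK // [z + _]addrC subrK.
rewrite normcME ler_wpM2r ?normc_ge0 //.
have hlim : normc (D (w - z) - l) <= 2 * K * normc (w - z).
  apply/ler_addgt0Pl => e' e'0.
  have [k Hk] := half_expn_small (K * q * 5) e'0.
  apply: (le_trans (normc_dist_le (D (h k)) _ _)).
  apply: (le_trans (lerD (cauchyD _ _ wz0 (h0 k) wq (hq k)) (Hl k))).
  rewrite mulrDr hn; set p := 2 ^+ k in Hk *.
  have E1 : K * (q / 2 / p) = K * q * 5 / p / 10 by field; rewrite expf_neq0.
  have E2 : 4 * (K * q) / p = K * q * 5 / p * (4 / 5) by field; rewrite expf_neq0.
  rewrite E1 E2.
  have : 0 < K * normc (w - z) by rewrite mulr_gt0.
  rewrite -[2 * K * _]mulrA; move: Hk.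
  by set X := K * q * 5 / p; set Y := K * normc (w - z); lra.
have K20 : 0 < 2 * K by rewrite mulr_gt0.
by apply: (le_trans hlim); move: we; rewrite (ltr_pdivlMr _ _ K20); lra.
Qed.

(** Local bounds and compactness of the circumscribed square. Its points are within [2 r] of [z], so
    discs of radius [r] about them stay in the domain. *)
Lemma deriv_bounded_ball f z (r : R) : 0 < r -> hol_ball f z (3 * r) ->
  exists M : R, forall u, normc (u - z) < r -> normc (cderiv f u) <= M.
Proof.
move=> r0 hf; case: z hf => [p q] hf.
pose S (x y w h : R) := exists M : R, forall a b : R, x <= a <= x + w -> y <= b <= y + h ->
  normc (cderiv f (Complex a b)) <= M.
have [M HM] : S (p - r) (q - r) (2 * r) (2 * r).
  apply: rectangle_bisection; [by rewrite mulr_ge0 ?ltW..| |].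
  - move=> x y w h w0 h0 [M1 H1] [M2 H2] [M3 H3] [M4 H4].
    exists (Num.max (Num.max M1 M2) (Num.max M3 M4)) => a b /andP[a1 a2] /andP[b1 b2].
    rewrite !le_max; have [aw|aw] := leP a (x + w / 2); have [bh|bh] := leP b (y + h / 2).
    + by rewrite H1 ?a1 ?b1.
    + by rewrite (H3 a b) ?a1 ?aw ?orbT ?(ltW bh) //=; lra.
    + by rewrite (H2 a b) ?b1 ?bh ?orbT ?(ltW aw) //=; lra.
    + by rewrite (H4 a b) ?orbT ?(ltW aw) ?(ltW bh) //=; lra.
  - move=> x y /andP[x1 x2] /andP[y1 y2].
    have xyr : normc (Complex x y - Complex p q) <= 2 * r.
      rewrite (le_trans (normc_le_ReIm _)) //= (_ : 2 * r = r + r); last by ring.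
      by rewrite lerD // ler_norml; apply/andP; split; lra.
    have [|s [B [s0 _ _ HB]]] := @deriv_locally_bounded f (Complex x y) r r0.
      by apply: hol_ballS hf; lra.
    exists (s / 2); first by rewrite divr_gt0.
    move=> x' y' w h /andP[h1 h2] /andP[h3 h4] ws hs; exists B => a b /andP[a1 a2] /andP[b1 b2].
    apply: HB; apply: (le_lt_trans (normc_le_ReIm _)) => /=.
    rewrite (_ : s = s / 2 + s / 2); last by field.
    by rewrite ltrD // ltr_norml; apply/andP; split; lra.
exists M => -[a b] ab.
have := le_lt_trans (normRe_le (Complex a b - Complex p q)) ab.
have := le_lt_trans (normIm_le (Complex a b - Complex p q)) ab.
rewrite /= !ltr_norml => /andP[? ?] /andP[? ?].
by apply: HM; lra.
Qed.

(** Newton's iteration with the fixed slope [a]. The new error [w - f x'] is, up to sign, the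
    deviation of [f] from slope [a] along the last step, hence at most half the old error. The steps
    sum to at most [2 c], and [4 c < t] keeps the limit in the disc. *)
Lemma newton_surjective f z w a (t : R) : 0 < t -> a != 0 ->
  (forall u, normc (u - z) < t -> ccont f u) ->
  (forall u v, normc (u - z) < t -> normc (v - z) < t ->
     normc (f v - f u - a * (v - u)) <= normc a / 2 * normc (v - u)) ->
  normc (w - f z) < normc a * t / 4 -> exists2 u, normc (u - z) < t & f u = w.
Proof.
move=> t0 a0 fc lip wt.
have na : 0 < normc a by rewrite normc_gt0.
pose x := fix x k := if k is k'.+1 then x k' + (w - f (x k')) / a else z.
pose c := normc (w - f z) / normc a.
have c0 : 0 <= c by rewrite divr_ge0 ?normc_ge0.
have ct : 4 * c < t.
  by rewrite /c mulrA ltr_pdivrMr //; lra.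
have inv k : normc (x k.+1 - x k) <= c / 2 ^+ k /\ normc (x k - z) <= 2 * c - 2 * c / 2 ^+ k.
  elim: k => [|k [ih1 ih2]].
    have -> : x 1%N - x 0%N = (w - f z) / a by rewrite /= addrAC subrr add0r.
    have -> : x 0%N - z = 0 by rewrite /= subrr.
    by rewrite expr0 !divr1 subrr normc0E normcME normcVE.
  have p0 : 0 < 2 ^+ k :> R by rewrite exprn_gt0.
  have cp0 : 0 <= c / 2 ^+ k by rewrite divr_ge0 // ltW.
  have E : c / 2 ^+ k.+1 = c / 2 ^+ k / 2 by rewrite exprSr invfM mulrA.
  have ih3 : normc (x k.+1 - z) <= 2 * c - 2 * c / 2 ^+ k.+1.
    apply: (le_trans (normc_dist_le (x k) _ _)); apply: (le_trans (lerD ih1 ih2)).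
    by rewrite -!(mulrA 2 c) E; lra.
  split=> //.
  have kt : normc (x k - z) < t by apply: le_lt_trans ih2 _; rewrite -(mulrA 2 c); lra.
  have kt1 : normc (x k.+1 - z) < t by apply: le_lt_trans ih3 _; rewrite -(mulrA 2 c) E; lra.
  have := lip _ _ kt kt1.
  have Ew : a * (x k.+1 - x k) = w - f (x k) by rewrite /=; field.
  rewrite Ew (_ : _ - _ - _ = - (w - f (x k.+1))); last by ring.
  rewrite normcN => hw.
  have -> : x k.+2 - x k.+1 = (w - f (x k.+1)) / a by rewrite /=; ring.
  rewrite normcME normcVE ler_pdivrMr // (le_trans hw) //.
  rewrite E [leRHS]mulrC -mulrA ler_wpM2l ?(ltW na) //; lra.
have [l Hl] := @geometric_limc R x c (fun k => (inv k).1).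
have lt : normc (l - z) < t.
  rewrite normc_distC; apply: le_lt_trans (_ : 4 * c < t) => //.
  by have := Hl 0%N; rewrite expr0 divr1.
exists l => //.
apply/eqP; rewrite -subr_eq0 -normc_eq0 eq_le normc_ge0 andbT.
apply/ler_addgt0Pl => e e0; rewrite addr0.
have /ccontP/(_ (e / 2)) := fc l lt; rewrite divr_gt0 // => /(_ isT)[d d0 Hd].
have [k1 Hk1] := half_expn_small (4 * c) d0.
have e2 : 0 < e / 2 / normc a by rewrite !divr_gt0.
have [k2 Hk2] := half_expn_small c e2.
have mono (b : R) m n : 0 <= b -> (m <= n)%N -> b / 2 ^+ n <= b / 2 ^+ m.
  move=> b0 mn; rewrite ler_wpM2l // lef_pV2 ?posrE ?exprn_gt0 //.
  by rewrite ler_weXn2l // ler1n.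
pose k := maxn k1 k2.
have fk : normc (f (x k) - f l) < e / 2.
  apply: Hd; apply: le_lt_trans (Hl k) (le_lt_trans _ Hk1).
  by rewrite mono ?leq_maxl // mulr_ge0.
have wk : normc (w - f (x k)) <= e / 2.
  have -> : w - f (x k) = (x k.+1 - x k) * a by rewrite /=; field.
  rewrite normcME -ler_pdivlMr //; apply: (le_trans (inv k).1); apply: le_trans (ltW Hk2).
  by rewrite mono ?leq_maxr.
have -> : f l - w = - ((w - f (x k)) + (f (x k) - f l)) by ring.
rewrite normcN (le_trans (normcD_le _ _)) //; move: wk fk; lra.
Qed.

(* At a point nearly maximizing [(r - |u - z|) |f'(u)|] the derivative is comparable to
its supremum over a disc of radius [(r - |u - z|) / 2], on a fixed fraction of which
[f] is therefore close to an affine map. *)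
Lemma bloch f z (r : R) : 0 < r -> hol_ball f z (3 * r) ->
  exists w0, forall w, normc (w - w0) < r * normc (cderiv f z) / 512 ->
    exists2 u, normc (u - z) < r & f u = w.
Proof.
move=> r0 hf.
have [d0|d0] := eqVneq (cderiv f z) 0.
  by exists 0 => w; rewrite d0 normc0E mulr0 mul0r => /(le_lt_trans (normc_ge0 _)); rewrite ltxx.
have nd : 0 < normc (cderiv f z) by rewrite normc_gt0.
have [M HM] := deriv_bounded_ball r0 hf.
pose g u := (r - normc (u - z)) * normc (cderiv f u).
pose A := [set g u | u in [set u | normc (u - z) < r]].
have Az : A (g z) by exists z => //=; rewrite subrr normc0E.
have gz : g z = r * normc (cderiv f z) by rewrite /g subrr normc0E subr0.
have supA : has_sup A.
  split; first by exists (g z).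
  exists (r * M) => _ [u /= ur <-]; rewrite /g ler_pM ?normc_ge0 ?subr_ge0 ?(ltW ur) //.
    by rewrite gerBl normc_ge0.
  exact: HM.
have S0 : 0 < sup A.
  by apply: lt_le_trans (_ : g z <= _); [rewrite gz mulr_gt0|exact: sup_upper_bound].
have [|_ [u /= ur <-] gu] := @sup_adherent _ A (sup A / 2) _ supA; first by rewrite divr_gt0.
have {}gu : sup A / 2 < g u by apply: le_lt_trans gu; lra.
pose s := (r - normc (u - z)) / 2.
have s0 : 0 < s by rewrite divr_gt0 // subr_gt0.
pose a := cderiv f u.
have guE : g u = 2 * s * normc a by rewrite /g /s /a; field.
have na : 0 < normc a.
  have : 0 < g u by apply: lt_trans gu; rewrite divr_gt0.
  by rewrite guE pmulr_rgt0 // mulr_gt0.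
have a0 : a != 0 by rewrite -normc_gt0.
have inr v : normc (v - u) < s -> normc (v - z) < r - s.
  move=> vu; apply: le_lt_trans (normc_dist_le u _ _) _.
  by move: vu; rewrite /s; lra.
(* [s |f' v| <= g v <= sup A < 2 g u = 4 s |a|]. *)
have der_s v : normc (v - u) < s -> normc (cderiv f v) <= 4 * normc a.
  move=> /inr vr.
  have vr' : normc (v - z) < r by lra.
  have : g v <= sup A by apply: sup_upper_bound => //; exists v.
  rewrite /g => gv.
  have : s * normc (cderiv f v) <= sup A.
    by apply: le_trans gv; rewrite ler_wpM2r ?normc_ge0 //; lra.
  move=> h; rewrite -(ler_pM2l s0); apply: (le_trans h).
  by move: gu; rewrite guE; lra.
have hs : hol_ball f u s.
  move=> v /inr vr; apply: hf; lra.
(* With radius [s / 2] and bound [4 |a|], [deriv_lipschitz] has the constant [16 |a| / s]; on radius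
   [s / 32] the derivative varies by at most [|a| / 2]. *)
pose t := s / 32.
have t0 : 0 < t by rewrite divr_gt0.
have ts v : normc (v - u) < t -> normc (v - u) < s.
  by move=> h; apply: lt_trans h _; rewrite /t; lra.
have lip v : normc (v - u) < t -> normc (cderiv f v - a) <= normc a / 2.
  move=> vt; have s20 : 0 < s / 2 by rewrite divr_gt0.
  have := @deriv_lipschitz f u v (s / 2) (4 * normc a) s20.
  rewrite [2 * (s / 2)]mulrC divfK // => /(_ hs der_s) h.
  apply: (le_trans (h _)); first by apply: lt_trans vt _; rewrite /t; lra.
  rewrite ler_pdivrMr //; move: vt; rewrite /t => /ltW vt.
  have := ler_wpM2l (ltW na) vt; rewrite mulrCA => k; lra.
exists (f u) => w wu.
have [|v1 v2 h1 h2||v vt fv] := @newton_surjective f u w a t t0 a0.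
- by move=> v vt; apply: cder_cont; apply/cderivP/hs/ts.
- have [|x x01] := @segment_mvt R (fun v => f v - a * v) (fun v => cderiv f v - a) v1 v2.
    move=> x x01; apply: cderB; last by apply: cder_eq (cderZ _ (cder_id _)) _; rewrite mulr1.
    by apply/cderivP/hs/ts/normc_convex.
  rewrite [X in normc X <= _](_ : _ = f v2 - f v1 - a * (v2 - v1)); last by ring.
  move=> h; apply: (le_trans h); rewrite ler_wpM2r ?normc_ge0 // lip //.
  exact: normc_convex.
(* Origin of 512: [|a| t / 4 = |a| s / 128 = g u / 256], and [g u > sup A / 2 >= g z / 2]. *)
- apply: (lt_le_trans wu); rewrite -gz.
  have : g z <= sup A by apply: sup_upper_bound.
  by move: gu; rewrite guE /t; lra.
- exists v => //; have := inr _ (ts _ vt); lra.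
Qed.

End Bloch.

(** * Univalent functions omitting a value *)

Section Convexity.
Variable R : realType.

Lemma segment_gt (a x y t : R) : 0 <= t <= 1 -> a < x -> a < y -> a < x + t * (y - x).
Proof.
move=> /andP[t0 t1] ax ay; have [->|tp] := eqVneq t 0; first by rewrite mul0r addr0.
have {}tp : 0 < t by rewrite lt_def tp.
have : 0 <= (1 - t) * (x - a) by rewrite mulr_ge0 // subr_ge0 // ltW.
have : 0 < t * (y - a) by rewrite mulr_gt0 // subr_gt0.
by lra.
Qed.

Lemma segment_ge (a x y t : R) : 0 <= t <= 1 -> a <= x -> a <= y -> a <= x + t * (y - x).
Proof.
move=> /andP[t0 t1] ax ay.
have : 0 <= (1 - t) * (x - a) by rewrite mulr_ge0 // subr_ge0.
have : 0 <= t * (y - a) by rewrite mulr_ge0 // subr_ge0.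
by lra.
Qed.

Lemma Re_segment (z w : R[i]) (t : R) :
  complex.Re (z + (t%:C)%C * (w - z)) = complex.Re z + t * (complex.Re w - complex.Re z).
Proof. by case: z w => [a b] [c d] /=; ring. Qed.

Lemma Im_segment (z w : R[i]) (t : R) :
  complex.Im (z + (t%:C)%C * (w - z)) = complex.Im z + t * (complex.Im w - complex.Im z).
Proof. by case: z w => [a b] [c d] /=; ring. Qed.

End Convexity.

Section OmittedValue.
Variable R : realType.
Implicit Types (z w u : R[i]).
Variables (phi : R[i] -> R[i]) (w0 : R[i]).
Hypothesis phi_conf : conformal_on_H phi.
Hypothesis phi_omits : ~ (phi @` upper_half R) w0.

Lemma conformal_cder z : 0 < complex.Im z -> cder phi z (cderiv phi z).
Proof. by move=> z0; apply: cderivP; apply: derivable_cder; exact: phi_conf.1. Qed.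

Lemma conformal_hol_ball z (r : R) : r <= complex.Im z -> hol_ball phi z r.
Proof.
move=> rz w wz; exists (cderiv phi w); apply: conformal_cder.
have := le_lt_trans (normIm_le (w - z)) wz; rewrite raddfB ltr_norml => /andP[h _].
by rewrite /= in h *; lra.
Qed.

Lemma omitted_neq0 z : 0 < complex.Im z -> phi z - w0 != 0.
Proof.
by move=> z0; rewrite subr_eq0; apply/eqP => E; apply: phi_omits; exists z.
Qed.

(* On a quadrant, [h] is a branch of [log (phi - w0)] up to a constant. *)
Lemma log_branch (a b : R) : 0 < b -> exists h k,
  forall z, a < complex.Re z -> b < complex.Im z ->
    cder h z (cderiv phi z / (phi z - w0)) /\ phi z - w0 = k * cexp (h z).
Proof.
move=> b0.
have dg z : a - 1 < complex.Re z -> 0 < complex.Im z ->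
    exists d, cder (fun z => cderiv phi z / (phi z - w0)) z d.
  move=> _ z0; have [d Hd] := deriv_holomorphic z0 (conformal_hol_ball (lexx _)).
  eexists; apply: cderM Hd _; apply: (@cder_comp _ (fun u => phi u - w0) (fun u => u^-1)).
    by apply: cderB; [exact: conformal_cder|exact: cder_cst].
  by apply: cderV; exact: omitted_neq0.
have a1 : a - 1 < a by rewrite gtrBl.
have [h dh] := quadrant_primitive a1 b0 dg.
(* [E' = 0], so [E] is constant on the convex quadrant and its value is [k]. *)
pose E z := (phi z - w0) * cexp (- h z).
have dE z : a < complex.Re z -> b < complex.Im z -> cder E z 0.
  move=> za zb; have z0 := lt_trans b0 zb.
  have D1 : cder (fun u => phi u - w0) z (cderiv phi z - 0).
    by apply: cderB; [exact: conformal_cder|exact: cder_cst].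
  have D2 := cder_comp (cderN (dh z za zb)) (cder_cexp (- h z)).
  apply: cder_eq (cderM D1 D2) _.
  by field; exact: omitted_neq0.
pose p := Complex (a + 1) (b + 1).
exists h, (E p) => z za zb; split; first exact: dh.
have : E z = E p.
  apply/eqP; rewrite -subr_eq0 -normc_eq0 eq_le normc_ge0 andbT.
  have [|t t01] := @segment_mvt R E (fun=> 0) p z; last by rewrite normc0E mul0r.
  by move=> t t01; apply: dE; rewrite ?Re_segment ?Im_segment segment_gt // /p /= ltrDl.
move=> <-; rewrite /E -mulrA -cexpD addNr cexp0 mulr1.
by [].
Qed.

(** Bloch's theorem yields [y / 6 * |h' z| / 512 <= 2 pi] with [y = Im z]; this is the resulting
    bound for [y |h' z|]. *)
Definition distortion_cst : R := 12 * 512 * pi.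

(* Univalence of [phi] prevents a branch [h] of [log (phi - w0)] from taking two values
which differ by [2 pi i], whereas Bloch's theorem provides large discs of values. *)
Lemma omitted_deriv_le z : 0 < complex.Im z ->
  normc (cderiv phi z) * complex.Im z <= distortion_cst * normc (phi z - w0).
Proof.
move=> z0; set y := complex.Im z in z0 *.
have y4 : 0 < y / 4 by rewrite divr_gt0.
have [h [k hk]] := log_branch (complex.Re z - y) y4.
have inQ u : normc (u - z) < y / 2 ->
    complex.Re z - y < complex.Re u /\ y / 4 < complex.Im u.
  move=> uz; have := le_lt_trans (normRe_le _) uz; have := le_lt_trans (normIm_le _) uz.
  rewrite !raddfB /= !ltr_norml -/y => /andP[h1 h2] /andP[h3 h4].
  by split; lra.
have zQ := inQ z; rewrite subrr normc0E divr_gt0 // in zQ; have {zQ}[zQ1 zQ2] := zQ isT.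
(* Bloch's theorem with radius [y / 6] needs a domain of radius [y / 2], which [inQ] places in the
   quadrant of [h]. *)
have y6 : 0 < y / 6 by rewrite divr_gt0.
have hh : hol_ball h z (3 * (y / 6)).
  move=> u uz; have [|u1 u2] := inQ u; first by apply: lt_le_trans uz _; lra.
  by eexists; exact: (hk u u1 u2).1.
have [v0 Hv] := bloch y6 hh.
have dhz : cderiv h z = cderiv phi z / (phi z - w0).
  by apply: (@cder_unique _ h z); [apply: cderivP; eexists|]; exact: (hk z zQ1 zQ2).1.
have [le2pi|gt2pi] := leP (y / 6 * normc (cderiv h z) / 512) (2 * pi).
  move: le2pi; rewrite dhz normcME normcVE.
  have nw : 0 < normc (phi z - w0) by rewrite normc_gt0 omitted_neq0.
  rewrite /distortion_cst -(ler_pdivrMr _ _ nw) => le2pi.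
  have -> : normc (cderiv phi z) * y / normc (phi z - w0) =
    6 * 512 * (y / 6 * (normc (cderiv phi z) / normc (phi z - w0)) / 512).
    by field; rewrite gt_eqF.
  by lra.
have pi2 : 0 < 2 * pi :> R by rewrite mulr_gt0 ?pi_gt0.
have [|u1 u1z hu1] := Hv v0; first by rewrite subrr normc0E (lt_trans pi2).
have [|u2 u2z hu2] := Hv (v0 + Complex 0 (2 * pi)).
  rewrite addrAC subrr add0r; apply: le_lt_trans gt2pi.
  by rewrite (le_trans (normc_le_ReIm _)) //= normr0 add0r ger0_norm // ltW.
have y62 : y / 6 < y / 2 by lra.
have [a1 b1] := inQ _ (lt_trans u1z y62); have [a2 b2] := inQ _ (lt_trans u2z y62).
have E : phi u1 = phi u2.
  apply: (addIr (- w0)); rewrite (hk u1 a1 b1).2 (hk u2 a2 b2).2 hu1 hu2.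
  by rewrite cexp_period.
have u12 : u1 = u2 by apply: phi_conf.2 => //; apply: lt_trans y4 _.
move: hu2; rewrite -u12 hu1 => /(congr1 (@complex.Im R)) /eqP.
by case: (v0) => x t /=; rewrite -subr_eq0 opprD addrA subrr sub0r oppr_eq0 gt_eqF.
Qed.

(** [Re h] is [log |phi - w0|] up to a constant, and [omitted_deriv_le] gives
    [|h'| <= distortion_cst / m] on the segment from [z] to [w], which stays at height at least
    [m]. *)
Lemma harnack z w (m l : R) : 0 < m -> m <= complex.Im z -> m <= complex.Im w ->
  normc (w - z) <= l ->
  normc (phi w - w0) <= expR (distortion_cst * l / m) * normc (phi z - w0).
Proof.
move=> m0 mz mw wzl.
have m2 : 0 < m / 2 by rewrite divr_gt0.
pose a := Num.min (complex.Re z) (complex.Re w) - 1.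
have az : a < complex.Re z by rewrite ltrBlDr; apply: le_lt_trans (_ : complex.Re z < _);
  rewrite ?ge_min ?lexx // ltrDl.
have aw : a < complex.Re w by rewrite ltrBlDr; apply: le_lt_trans (_ : complex.Re w < _);
  rewrite ?ge_min ?lexx ?orbT // ltrDl.
have [h [k hk]] := log_branch a m2.
have seg (t : R) : 0 <= t <= 1 ->
    a < complex.Re (z + (t%:C)%C * (w - z)) /\ m <= complex.Im (z + (t%:C)%C * (w - z)).
  by move=> t01; rewrite Re_segment Im_segment segment_gt ?segment_ge.
have [|t t01] := @segment_mvt R h (fun u => cderiv phi u / (phi u - w0)) z w.
  by move=> t /seg[h1 h2]; apply: (hk _ _ _).1 => //; apply: lt_le_trans h2; lra.
set u := z + _ => hwz.
have [ua um] := seg t t01; rewrite -/u in ua um.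
have u0 : 0 < complex.Im u by exact: lt_le_trans um.
have mz' : m / 2 < complex.Im z by lra.
have mw' : m / 2 < complex.Im w by lra.
rewrite (hk w aw mw').2 (hk z az mz').2 !normcME !normc_cexp mulrCA.
rewrite ler_wpM2l ?normc_ge0 // -expRD ler_expR -lerBlDr -raddfB.
apply: (le_trans (ler_norm _)); apply: (le_trans (normRe_le _)); apply: (le_trans hwz).
rewrite [leRHS]mulrAC ler_pM ?normc_ge0 //.
rewrite normcME normcVE; have nw : 0 < normc (phi u - w0) by rewrite normc_gt0 omitted_neq0.
rewrite ler_pdivlMr // mulrAC ler_pdivrMr //.
by apply: le_trans (omitted_deriv_le u0); rewrite ler_wpM2l ?normc_ge0.
Qed.

Definition clamp_dist (eps : R) z := Num.min (normc (phi z - w0)) eps.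

Lemma clamp_dist_le (eps : R) z w :
  `|clamp_dist eps z - clamp_dist eps w| <= normc (phi z - phi w).
Proof.
have h1 : normc (phi z - w0) <= normc (phi z - phi w) + normc (phi w - w0) by exact: normc_dist_le.
have h2 : normc (phi w - w0) <= normc (phi z - phi w) + normc (phi z - w0).
  by rewrite [normc (phi z - phi w)]normc_distC; exact: normc_dist_le.
have h3 := normc_ge0 (phi z - phi w).
rewrite /clamp_dist /Num.min; case: ifP => c1; case: ifP => c2;
  rewrite ler_norml; apply/andP; split; move: c1 c2;
  do ?[move/negbT; rewrite -leNgt => ?|move=> ?]; lra.
Qed.

(* An increment of [clamp_dist] along an edge is paid for by the area of a disc of
values that [phi] takes near the edge. *)
Lemma edge_disc (eps d : R) z0 z1 : 0 < eps -> 0 < d ->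
  d <= complex.Im z0 -> d <= complex.Im z1 -> normc (z1 - z0) <= 2 * d ->
  exists c, forall w,
    normc (w - c) < `|clamp_dist eps z1 - clamp_dist eps z0| / (32 * 512) ->
    exists2 u, phi u = w & [/\ exists2 t : R, 0 <= t <= 1 &
         normc (u - (z0 + (t%:C)%C * (z1 - z0))) < d / 16,
       0 < complex.Im u &
       normc (w - w0) <= expR (6 * distortion_cst) * eps].
Proof.
move=> eps0 d0 dz0 dz1 z01.
set a := `|_|.
have [a0|a0] := eqVneq a 0.
  by exists 0 => w; rewrite a0 mul0r => /(le_lt_trans (normc_ge0 _)); rewrite ltxx.
have seg (t : R) : 0 <= t <= 1 -> d <= complex.Im (z0 + (t%:C)%C * (z1 - z0)).
  by move=> t01; rewrite Im_segment segment_ge.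
have [|t t01] := @segment_mvt R phi (cderiv phi) z0 z1.
  by move=> t t01; apply: conformal_cder; exact: lt_le_trans (seg t t01).
set p := z0 + _ => hp.
have pd : d <= complex.Im p := seg t t01.
(* As [a <= 2 d |phi' p|], the radius [d / 16 * |phi' p| / 512] of Bloch's theorem is at least
   [a / (32 * 512)]. The preimages move by less than [d / 16], the margin of [edge_box]. *)
have d16 : 0 < d / 16 by rewrite divr_gt0.
have [|c Hc] := @bloch R phi p (d / 16) d16.
  by apply: conformal_hol_ball; lra.
exists c => w wc.
have [|u up uw] := Hc w.
  apply: lt_le_trans wc _.
  have : a <= normc (cderiv phi p) * (2 * d).
    apply: (le_trans (clamp_dist_le eps z1 z0)); apply: (le_trans hp).
    by rewrite ler_wpM2l ?normc_ge0.
  by lra.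
exists u => //.
have uIm : d / 2 <= complex.Im u.
  have := le_lt_trans (normIm_le _) up; rewrite raddfB /= ltr_norml => /andP[h _]; lra.
split; first by exists t.
  by apply: lt_le_trans uIm; rewrite divr_gt0.
have d20 : 0 < d / 2 by rewrite divr_gt0.
(* Harnack's inequality from an endpoint where [|phi - w0| < eps]; [l = 3 d] and [m = d / 2] give
   the factor [exp (6 * distortion_cst)]. *)
have conclude z : d <= complex.Im z -> normc (p - z) <= 2 * d -> normc (phi z - w0) < eps ->
    normc (w - w0) <= expR (6 * distortion_cst) * eps.
  move=> zd pz ze; rewrite -uw.
  have := @harnack z u (d / 2) (3 * d) d20 _ uIm.
  have -> : distortion_cst * (3 * d) / (d / 2) = 6 * distortion_cst by field; rewrite gt_eqF.
  move=> H; apply: le_trans (H _ _) _; first by lra.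
    by apply: (le_trans (normc_dist_le p _ _)); lra.
  by rewrite ler_wpM2l ?expR_ge0 // ltW.
have /andP[t0 t1] := t01.
have [lt0|ge0] := ltP (normc (phi z0 - w0)) eps.
  apply: conclude lt0 => //.
  have -> : p - z0 = (t%:C)%C * (z1 - z0) by rewrite /p; ring.
  rewrite normcME normc_real ger0_norm // (le_trans _ z01) //.
  by rewrite ler_piMl ?normc_ge0.
have [lt1|ge1] := ltP (normc (phi z1 - w0)) eps.
  apply: conclude lt1 => //.
  have -> : p - z1 = ((t - 1)%:C)%C * (z1 - z0) by rewrite /p raddfB /=; ring.
  rewrite normcME normc_real ler0_norm ?subr_le0 // (le_trans _ z01) //.
  by rewrite ler_piMl ?normc_ge0 //; lra.
(* Otherwise both truncated values are [eps] and the increment [a] vanishes. *)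
by move: a0; rewrite /a /clamp_dist !min_r // subrr normr0 eqxx.
Qed.

End OmittedValue.

(** * Packing of discs *)

Section Packing.
Variable R : realType.

Lemma measure_packing d (T : measurableType d) (mu : {measure set T -> \bar R})
    (I : eqType) (s : seq I) (S : I -> set T) (B : set T) : uniq s ->
  measurable B -> (forall i, i \in s -> measurable (S i)) ->
  (forall i, i \in s -> S i `<=` B) ->
  (forall i j, i \in s -> j \in s -> i != j -> S i `&` S j = set0) ->
  (\sum_(i <- s) mu (S i) <= mu B)%E.
Proof.
elim: s B => [|i s ih] B /=; first by rewrite big_nil.
move=> /andP[nis us] mB mS SB disj; rewrite big_cons.
have mSi : measurable (S i) by apply: mS; rewrite mem_head.
have SiB : S i `<=` B by apply: SB; rewrite mem_head.
rewrite -[in leRHS](setDUK SiB) measureU //; last 2 first.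
- exact: measurableD.
- by rewrite setDIK.
rewrite leeD2l //; apply: ih => //.
- exact: measurableD.
- by move=> j js; apply: mS; rewrite inE js orbT.
- move=> j js x Sjx; split; first by apply: (SB j) => //; rewrite inE js orbT.
  move=> Six; have : (S i `&` S j) x by [].
  rewrite disj ?mem_head //; first by rewrite inE js orbT.
  by apply: contraNneq nis => ->.
- by move=> j k js ks; apply: disj; rewrite inE ?js ?ks orbT.
Qed.

Definition square (x y r : R) : set (R * R) := `]x - r, x + r[ `*` `]y - r, y + r[.

Lemma square_area x y r : 0 <= r ->
  ((@lebesgue_measure R) \x (@lebesgue_measure R))%E (square x y r) = ((2 * r) ^+ 2)%:E.
Proof.
move=> r0; have len (z : R) : lebesgue_measure `]z - r, z + r[%classic = (2 * r)%:E.
  rewrite lebesgue_measure_itv /= lte_fin.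
  case: ifPn => [_|]; first by rewrite -EFinB; congr EFin; ring.
  by rewrite -leNgt => h; congr EFin; lra.
rewrite product_measure1E //=; do 2 rewrite len.
by rewrite -EFinM expr2.
Qed.

(** Squares replace discs, so that only products of intervals are measured: a square of side [r i]
    lies in the disc of radius [r i], and an open square of side [4 B] contains the closed disc of
    radius [B]. *)
Lemma disc_packing (I : finType) (P : pred I) (c : I -> R[i]) (r : I -> R) (w0 : R[i]) (B : R) :
  0 < B -> (forall i, P i -> 0 <= r i) ->
  (forall i w, P i -> normc (w - c i) < r i -> normc (w - w0) <= B) ->
  (forall i j w, P i -> P j -> normc (w - c i) < r i -> normc (w - c j) < r j -> i = j) ->
  \sum_(i | P i) r i ^+ 2 <= (4 * B) ^+ 2.
Proof.
move=> B0 r0 inB disj.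
pose mu := ((@lebesgue_measure R) \x (@lebesgue_measure R))%E.
pose S i := square (complex.Re (c i)) (complex.Im (c i)) (r i / 2).
have in_disc i p : S i p -> normc (Complex p.1 p.2 - c i) < r i.
  move=> [/=]; rewrite !in_itv /= => /andP[h1 h2] /andP[h3 h4].
  apply: (le_lt_trans (normc_le_ReIm _)).
  move: h1 h2 h3 h4; case: (c i) => x y /= h1 h2 h3 h4.
  rewrite (_ : r i = r i / 2 + r i / 2); last by field.
  by rewrite ltrD // ltr_norml; apply/andP; split; lra.
have mSq x y t : measurable (square x y t) by apply: measurableX; exact: measurable_itv.
have B2 : 0 <= 2 * B by rewrite mulr_ge0 // ltW.
rewrite -lee_fin (_ : 4 * B = 2 * (2 * B)); last by ring.
rewrite -(square_area (complex.Re w0) (complex.Im w0) B2) -/mu.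
rewrite (_ : (_ %:E) = (\sum_(i <- [seq i <- index_enum I | P i]) mu (S i))%E).
  apply: measure_packing.
  - by rewrite filter_uniq // index_enum_uniq.
  - exact: mSq.
  - by move=> i _; exact: mSq.
  - move=> i; rewrite mem_filter => /andP[Pi _] p Sp.
    have := inB i _ Pi (in_disc i p Sp) => pB.
    have := le_trans (normRe_le _) pB; have := le_trans (normIm_le _) pB.
    rewrite !raddfB /= !ler_norml => /andP[h1 h2] /andP[h3 h4].
    by split => /=; rewrite in_itv /=; apply/andP; split; lra.
  - move=> i j; rewrite !mem_filter => /andP[Pi _] /andP[Pj _] ij.
    apply/seteqP; split=> // p [Sip Sjp]; move: ij.
    by rewrite (disj i j _ Pi Pj (in_disc _ _ Sip) (in_disc _ _ Sjp)) eqxx.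
rewrite big_filter -sumEFin; apply: eq_bigr => i Pi.
by rewrite /mu square_area ?divr_ge0 ?r0 //; congr EFin; congr (_ ^+ 2); field.
Qed.

End Packing.

(** * Logarithmic energy *)

Section StepFunctions.
Context (R : realType) (d : measure_display) (T : measurableType d).
Variable mu : probability T R.

Lemma integrable_step (I : Type) (s : seq I) (a : I -> R) (A : I -> set T) (b : R) :
  (forall i, measurable (A i)) ->
  mu.-integrable setT (EFin \o (fun x => \sum_(i <- s) a i * \1_(A i) x + b)) /\
  (\int[mu]_x (\sum_(i <- s) a i * \1_(A i) x + b)%:E =
   (\sum_(i <- s) a i * fine (mu (A i)) + b)%:E)%E.
Proof.
move=> mA; elim: s => [|i s [ih1 ih2]].
  split.
    apply: (eq_integrable _ (EFin \o cst b)) => //.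
      by move=> x _ /=; rewrite big_nil add0r.
    exact: finite_measure_integrable_cst.
  under eq_integral do rewrite big_nil add0r.
  rewrite big_nil add0r integral_cst //.
  by rewrite -[RHS]mule1; congr (_ * _)%E; exact: probability_setT.
have iA : mu.-integrable setT (EFin \o (fun x => a i * \1_(A i) x)).
  have -> : EFin \o (fun x => a i * \1_(A i) x) = (fun x => (a i)%:E * (\1_(A i) x)%:E)%E.
    by apply/funext => x /=; rewrite EFinM.
  by apply: integrableZl => //; exact: integrable_indic.
have E : (fun x => \sum_(j <- i :: s) a j * \1_(A j) x + b) =
    (fun x => a i * \1_(A i) x + (\sum_(j <- s) a j * \1_(A j) x + b)).
  by apply/funext => x; rewrite big_cons addrA.
rewrite E; split.
  by move: (integrableD measurableT iA ih1); exact: eq_integrable.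
transitivity (\int[mu]_x (a i * \1_(A i) x)%:E +
    \int[mu]_x (\sum_(j <- s) a j * \1_(A j) x + b)%:E)%E.
  rewrite -(integralD measurableT iA ih1); apply: eq_integral => x _ /=.
  by rewrite big_cons -addrA.
rewrite ih2.
under eq_integral do rewrite EFinM.
rewrite integralZl //; last first.
  exact: integrable_indic.
transitivity ((a i)%:E * (fine (mu (A i)))%:E +
    (\sum_(j <- s) a j * fine (mu (A j)) + b)%:E)%E; last first.
  by rewrite big_cons -addrA.
congr (_ * _ + _)%E; rewrite integral_indic // setIT fineK //.
exact: fin_num_measure.
Qed.

(** The energy may be infinite, so integrability is not assumed; positive and negative parts are
    compared separately. *)
Lemma le_integral_negligible (f g : T -> \bar R) (N : set T) :
  measurable_fun setT f -> measurable_fun setT g -> measurable N -> mu N = 0%E ->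
  (forall x, ~ N x -> (f x <= g x)%E) -> (\int[mu]_x f x <= \int[mu]_x g x)%E.
Proof.
move=> mf mg mN N0 fg; rewrite integralE [leRHS]integralE leeB //.
- apply: ae_ge0_le_integral => //; [exact: measurable_funepos..|].
  exists N; split=> // x /= h; apply: contrapT => Nx; apply: h => _.
  apply: (@funepos_le _ _ [set x] f g); last by rewrite inE.
  by move=> y /[!inE] /= ->; exact: fg.
- apply: ae_ge0_le_integral => //; [exact: measurable_funeneg..|].
  exists N; split=> // x /= h; apply: contrapT => Nx; apply: h => _.
  apply: (@funeneg_le _ _ [set x] f g); last by rewrite inE.
  by move=> y /[!inE] /= ->; exact: fg.
Qed.

End StepFunctions.

Section Energy.
Variable R : realType.
Variable mu : probability R R.

Lemma measurable_log_kernel :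
  measurable_fun setT (fun p : R * R => log_kernel p.1 p.2).
Proof.
rewrite /log_kernel; apply: measurable_fun_ifT.
- by apply: measurable_fun_eqr; [exact: measurable_fst|exact: measurable_snd].
- exact: measurable_cst.
- apply/measurable_EFinP; apply: measurable_funN.
  apply: (measurableT_comp (@measurable_ln R)).
  apply: (measurableT_comp (@normr_measurable R setT)).
  by apply: measurable_funB; [exact: measurable_fst|exact: measurable_snd].
Qed.

Lemma measurable_log_potential :
  measurable_fun setT (fun x => \int[mu]_y log_kernel x y)%E.
Proof.
pose k (p : R * R) : \bar R := log_kernel p.1 p.2.
pose F1 x := (\int[mu]_y (k^\+ (x, y)))%E; pose F2 x := (\int[mu]_y (k^\- (x, y)))%E.
have -> : (fun x => \int[mu]_y log_kernel x y)%E = (fun x => F1 x - F2 x)%E.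
  apply/funext => x; rewrite [LHS]integralE /F1 /F2; congr (_ - _)%E.
    by apply: eq_integral => y _; rewrite !funeposE; reflexivity.
  by apply: eq_integral => y _; rewrite !funenegE; reflexivity.
apply: (@emeasurable_funB _ _ _ setT F1 F2).
- apply: (@measurable_fun_fubini_tonelli_F _ _ _ _ _ mu k^\+)%E => //.
  by apply: measurable_funepos; exact: measurable_log_kernel.
- apply: (@measurable_fun_fubini_tonelli_F _ _ _ _ _ mu k^\-)%E => //.
  by apply: measurable_funeneg; exact: measurable_log_kernel.
Qed.

(** A step function below the kernel is integrated twice. It has to lie below the kernel only for
    [x], [y] in [K], which carries [mu]. *)
Lemma log_energy_ge (I : Type) (s : seq I) (A : I -> set R) (c b : R) (K : set R) :
  measurable K -> mu (~` K) = 0%E -> (forall i, measurable (A i)) ->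
  (forall x y, K x -> K y ->
    ((\sum_(i <- s) c * (\1_(A i) x * \1_(A i) y) - b)%:E <= log_kernel x y)%E) ->
  ((\sum_(i <- s) c * fine (mu (A i)) ^+ 2 - b)%:E <= log_energy mu)%E.
Proof.
move=> mK K0 mA H.
have inner x : (\int[mu]_y (\sum_(i <- s) c * (\1_(A i) x * \1_(A i) y) - b)%:E =
    (\sum_(i <- s) c * (\1_(A i) x * fine (mu (A i))) - b)%:E)%E.
  under eq_integral do under eq_bigr do rewrite mulrA.
  rewrite (integrable_step mu s (fun i => c * \1_(A i) x) (- b) mA).2.
  by congr (_ - _)%:E; apply: eq_bigr => i _; rewrite mulrA.
have outer : (\int[mu]_x (\sum_(i <- s) c * (\1_(A i) x * fine (mu (A i))) - b)%:E =
    (\sum_(i <- s) c * fine (mu (A i)) ^+ 2 - b)%:E)%E.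
  have E x : \sum_(i <- s) c * (\1_(A i) x * fine (mu (A i))) =
      \sum_(i <- s) (c * fine (mu (A i))) * \1_(A i) x.
    by apply: eq_bigr => i _; rewrite [X in c * X]mulrC mulrA.
  under eq_integral do rewrite E.
  rewrite (integrable_step mu s (fun i => c * fine (mu (A i))) (- b) mA).2.
  by congr (_ - _)%:E; apply: eq_bigr => i _; rewrite -mulrA.
have mstep (a : I -> R) : measurable_fun setT (fun x => (\sum_(i <- s) a i * \1_(A i) x - b)%:E).
  exact: (measurable_int mu (integrable_step mu s a (- b) mA).1).
have mKC : measurable (~` K) by exact: measurableC.
rewrite -outer /log_energy; apply: (@le_integral_negligible _ _ _ mu _ _ (~` K)) => //.
- have E : (fun x => (\sum_(i <- s) c * (\1_(A i) x * fine (mu (A i))) - b)%:E) =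
     (fun x => (\sum_(i <- s) (c * fine (mu (A i))) * \1_(A i) x - b)%:E).
    apply/funext => x; congr (_ - _)%:E; apply: eq_bigr => i _.
    by rewrite [X in c * X]mulrC mulrA.
  by rewrite E; exact: mstep.
- exact: measurable_log_potential.
- move=> x /contrapT Kx; rewrite -inner.
  apply: (@le_integral_negligible _ _ _ mu _ _ (~` K)) => //.
  + have E : (fun y => (\sum_(i <- s) c * (\1_(A i) x * \1_(A i) y) - b)%:E) =
       (fun y => (\sum_(i <- s) (c * \1_(A i) x) * \1_(A i) y - b)%:E).
      by apply/funext => y; congr (_ - _)%:E; apply: eq_bigr => i _; rewrite mulrA.
    by rewrite E; exact: mstep.
  + exact: (measurableT_comp measurable_log_kernel (pair1_measurable x)).
  + by move=> y /contrapT Ky; exact: H.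
Qed.

End Energy.

(** * Dyadic intervals *)

Section DyadicCells.
Variables (R : realType) (al ell : R).
Hypothesis ell0 : 0 < ell.

Definition dyadic_coord (k : nat) (t : R) : R := 2 ^+ k * (t - al) / ell.

(* The right endpoint of the interval is attached to the last cell. *)
Definition dyadic_index (k : nat) (t : R) : nat :=
  minn (Num.truncn (dyadic_coord k t)) (2 ^ k).-1.

Definition dyadic_cell (k j : nat) : set R := [set t | dyadic_index k t = j].

Lemma leq_truncn (m : nat) (x : R) : (0 < m)%N -> (m <= Num.truncn x)%N = (m%:R <= x).
Proof.
by case: m => // m _; rewrite ltnNge truncn_le_nat -leNgt.
Qed.

Lemma dyadic_index_lt k t : (dyadic_index k t < 2 ^ k)%N.
Proof. by rewrite /dyadic_index gtn_min ltn_predL expn_gt0 orbT. Qed.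

Lemma measurable_dyadic_cell k j : measurable (dyadic_cell k j).
Proof.
have ge m : measurable [set t | (m <= dyadic_index k t)%N].
  case: m => [|m].
    by rewrite (_ : [set t | _] = setT) //; apply/seteqP; split.
  have [mk|mk] := leqP m.+1 (2 ^ k).-1; last first.
    rewrite (_ : [set t | _] = set0) //; apply/seteqP; split=> // t /=.
    by rewrite /dyadic_index leq_min => /andP[_ /(leq_trans mk)]; rewrite ltnn.
  rewrite (_ : [set t | _] = `[al + m.+1%:R * ell / 2 ^+ k, +oo[%classic).
    exact: measurable_itv.
  apply/seteqP; split=> t /=; rewrite in_itv /= andbT /dyadic_index leq_min mk andbT
    leq_truncn // /dyadic_coord ler_pdivlMr // -lerBrDl ler_pdivrMr ?exprn_gt0 //;
    by rewrite [(t - al) * _]mulrC.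
rewrite (_ : dyadic_cell k j = [set t | (j <= dyadic_index k t)%N] `\`
    [set t | (j.+1 <= dyadic_index k t)%N]).
  exact: measurableD.
apply/seteqP; split=> t /=; rewrite /dyadic_cell /=.
  by move=> ->; rewrite ltnn; split.
by move=> [h1 /negP]; rewrite -leqNgt => h2; apply/eqP; rewrite eqn_leq h1 h2.
Qed.

(** The index of the parent cell. The cut-off at the right end is compatible with halving since
    [2^(k+1) - 1] halves to [2^k - 1]. *)
Lemma dyadic_index_half k t : al <= t ->
  (dyadic_index k.+1 t)./2 = dyadic_index k t.
Proof.
move=> alt; have x0 : 0 <= dyadic_coord k t.
  by rewrite !mulr_ge0 ?subr_ge0 ?invr_ge0 ?(ltW ell0) ?exprn_ge0.
have xS : dyadic_coord k.+1 t = 2 * dyadic_coord k t.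
  by rewrite /dyadic_coord exprS !mulrA.
set n := Num.truncn (dyadic_coord k t); set m := Num.truncn (dyadic_coord k.+1 t).
have n1 : n%:R <= dyadic_coord k t by rewrite truncn_le.
have n2 : dyadic_coord k t < n.+1%:R by exact: truncnS_gt.
have m1 : (n.*2 <= m)%N.
  case: (posnP n) => [->//|n0]; rewrite leq_truncn ?double_gt0 // xS.
  by rewrite -muln2 natrM mulrC ler_wpM2l.
have m2 : (m < n.+1.*2)%N.
  rewrite ltnNge leq_truncn // xS -ltNge.
  by rewrite -muln2 natrM [X in _ < X]mulrC ltr_pM2l.
have p0 : (0 < 2 ^ k)%N by rewrite expn_gt0.
rewrite /dyadic_index -/n -/m expnS.
move: (2 ^ k)%N p0 m1 m2 => p p0 m1 m2; lia.
Qed.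

Lemma dyadic_index_bounds k t : al <= t <= al + ell ->
  (dyadic_index k t)%:R * ell / 2 ^+ k <= t - al <= ((dyadic_index k t)%:R + 1) * ell / 2 ^+ k.
Proof.
move=> /andP[alt tal].
have p0 : 0 < 2 ^+ k :> R by rewrite exprn_gt0.
have x0 : 0 <= dyadic_coord k t.
  by rewrite !mulr_ge0 ?subr_ge0 ?invr_ge0 ?(ltW ell0) ?exprn_ge0.
have x1 : dyadic_coord k t <= 2 ^+ k.
  by rewrite /dyadic_coord ler_pdivrMr // ler_wpM2l ?(ltW p0) //; lra.
have E : t - al = dyadic_coord k t * ell / 2 ^+ k.
  by rewrite /dyadic_coord; field; rewrite !gt_eqF.
rewrite E; set x := dyadic_coord k t in x0 x1 *.
have cancel (u v : R) : u <= v -> u * ell / 2 ^+ k <= v * ell / 2 ^+ k.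
  by move=> uv; rewrite ler_wpM2r ?invr_ge0 ?(ltW p0) // ler_wpM2r // ltW.
apply/andP; split; apply: cancel.
  apply: le_trans (_ : (Num.truncn x)%:R <= _); last by rewrite truncn_le.
  by rewrite ler_nat /dyadic_index geq_minl.
have [h|h] := leqP (Num.truncn x) (2 ^ k).-1.
  rewrite /dyadic_index (minn_idPl h) natr1; exact/ltW/truncnS_gt.
rewrite /dyadic_index (minn_idPr (ltnW h)) natr1 prednK ?expn_gt0 //.
by rewrite natrX.
Qed.

Lemma dyadic_cell_dist k s t : al <= s <= al + ell -> al <= t <= al + ell ->
  dyadic_index k s = dyadic_index k t -> 2 ^+ k * `|s - t| <= ell.
Proof.
move=> hs ht E; have := dyadic_index_bounds k hs; have := dyadic_index_bounds k ht.
rewrite E => /andP[h1 h2] /andP[h3 h4].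
have p0 : 0 < 2 ^+ k :> R by rewrite exprn_gt0.
rewrite mulrC -ler_pdivlMr //.
have E2 : ((dyadic_index k t)%:R + 1) * ell / 2 ^+ k =
    (dyadic_index k t)%:R * ell / 2 ^+ k + ell / 2 ^+ k by rewrite !mulrDl mul1r.
rewrite E2 in h2 h4; rewrite ler_norml; apply/andP; split; lra.
Qed.

(** If [N] is the last common level then [2^N |s - t| <= ell], and the number of common levels is at
    most [N]. The induction therefore also carries the trivial bound of the count by [M]. *)
Lemma dyadic_common_count M s t : al <= s <= al + ell -> al <= t <= al + ell -> s != t ->
  ln 2 * (\sum_(k < M) (dyadic_index k.+1 s == dyadic_index k.+1 t))%:R
    <= ln ell - ln `|s - t|.
Proof.
move=> hs ht st.
have d0 : 0 < `|s - t| by rewrite normr_gt0 subr_eq0.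
have [H cM] : 2 ^+ (\sum_(k < M) (dyadic_index k.+1 s == dyadic_index k.+1 t)) * `|s - t| <= ell
    /\ (\sum_(k < M) (dyadic_index k.+1 s == dyadic_index k.+1 t) <= M)%N.
  elim: M => [|M [ih1 ih2]].
    rewrite big_ord0 expr0 mul1r; split=> //; rewrite ler_norml.
    by case/andP: hs => ? ?; case/andP: ht => ? ?; apply/andP; split; lra.
  rewrite big_ord_recr /=; case: eqP => [E|_]; last first.
    by rewrite addn0; split=> //; exact: leqW.
  rewrite addn1; split=> //; apply: le_trans (dyadic_cell_dist hs ht E).
  by rewrite ler_wpM2r ?(ltW d0) // ler_weXn2l // ler1n.
rewrite lerBrDr mulrC mulr_natl -lnXn // -lnM ?posrE ?exprn_gt0 //.
by rewrite ler_ln ?posrE ?mulr_gt0 ?exprn_gt0.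
Qed.

End DyadicCells.

(** * Capacity and dyadic trees *)

Section TreeCapacity.
Variables (R : realType) (al ell : R).
Hypothesis ell0 : 0 < ell.
Notation index := (dyadic_index al ell).
Notation cell := (dyadic_cell al ell).

Definition cell_index M (i : 'I_M * 'I_(2 ^ M)) : set R := cell i.1.+1 i.2.

Lemma sum_cell_indic M (f : nat -> nat -> R) t :
  \sum_(i : 'I_M * 'I_(2 ^ M)) f i.1 i.2 * \1_(cell_index i) t =
  \sum_(k < M) f k (index k.+1 t).
Proof.
rewrite -(pair_big xpredT xpredT (fun (k : 'I_M) (j : 'I_(2 ^ M)) => f k j * \1_(cell k.+1 j) t)) /=.
apply: eq_bigr => k _.
have lt : (index k.+1 t < 2 ^ M)%N.
  by apply: leq_trans (dyadic_index_lt _ _ _ _) _; rewrite leq_exp2l.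
rewrite (bigD1 (Ordinal lt)) //= big1 ?addr0 => [|j jk].
  by rewrite indicE mem_set ?mulr1.
rewrite indicE memNset ?mulr0 // /dyadic_cell /= => E.
by move/eqP: jk; apply; apply/val_inj; rewrite /= E.
Qed.

Lemma log_energy_ge_cells M (mu : probability R R) (K : set R) :
  compact K -> K `<=` [set t | al <= t <= al + ell] -> mu (~` K) = 0%E ->
  ((ln 2 * \sum_(i : 'I_M * 'I_(2 ^ M)) fine (mu (cell_index i)) ^+ 2 - ln ell)%:E
     <= log_energy mu)%E.
Proof.
move=> cK KI K0; rewrite mulr_sumr.
apply: (@log_energy_ge _ mu _ (index_enum _) (@cell_index M) (ln 2) (ln ell) K) => //.
- exact: closed_measurable (compact_closed (@Rhausdorff R) cK).
- by move=> i; exact: measurable_dyadic_cell.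
- move=> s t /KI hs /KI ht; rewrite /log_kernel; case: eqVneq => [_|st]; first exact: leey.
  rewrite lee_fin -mulr_sumr.
  rewrite (@sum_cell_indic M (fun k j => \1_(cell k.+1 j) s)).
  have -> : \sum_(k < M) \1_(cell k.+1 (index k.+1 t)) s =
      ((\sum_(k < M) (index k.+1 s == index k.+1 t))%N)%:R :> R.
    rewrite natr_sum; apply: eq_bigr => k _; rewrite indicE.
    by congr (_%:R); congr nat_of_bool; apply/idP/eqP => [/set_mem|/mem_set].
  by have := dyadic_common_count ell0 M hs ht st; lra.
Qed.

(* [a k j] is the increment along the edge from the cell [j] of level [k + 1] to its
parent. If on [K] the increments sum up to [c] then [c / 2 <= sum a mu(cell)] for [M]
large, and the weighted inequality [2 a m <= th a^2 + m^2 / th] gives a lower bound for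
the sum of the squares of [mu(cell)], that is for the energy. *)
Lemma log_energy_ge_tree (mu : probability R R) (K : set R) (a : nat -> nat -> R) (c D : R) :
  compact K -> K `<=` [set t | al <= t <= al + ell] -> mu (~` K) = 0%E ->
  0 < c -> 0 < D -> (forall k j, 0 <= a k j) ->
  (forall t, K t -> exists M, c <= \sum_(k < M) a k (index k.+1 t)) ->
  (forall M, \sum_(i : 'I_M * 'I_(2 ^ M)) a i.1 i.2 ^+ 2 <= D) ->
  ((ln 2 * (c ^+ 2 / (4 * D)) - ln ell)%:E <= log_energy mu)%E.
Proof.
move=> cK KI K0 c0 D0 a0 Hc HD.
pose S M t := \sum_(k < M) a k (index k.+1 t).
pose F M := [set t | c <= S M t].
have SE M t : S M t = \sum_(i : 'I_M * 'I_(2 ^ M)) a i.1 i.2 * \1_(cell_index i) t + 0.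
  by rewrite addr0 (@sum_cell_indic M a).
have mcell M (i : 'I_M * 'I_(2 ^ M)) : measurable (cell_index i).
  exact: measurable_dyadic_cell.
have mK : measurable K by exact: closed_measurable (compact_closed (@Rhausdorff R) cK).
have mS M : measurable_fun setT (S M).
  have -> : S M = (fun t => \sum_(i : 'I_M * 'I_(2 ^ M)) a i.1 i.2 * \1_(cell_index i) t + 0).
    by apply/funext => t; exact: SE.
  apply/measurable_EFinP; apply: (measurable_int mu).
  exact: (integrable_step mu (index_enum _) (fun i : 'I_M * 'I_(2 ^ M) => a i.1 i.2) 0 (mcell M)).1.
have mF M : measurable (F M).
  rewrite (_ : F M = setT `&` S M @^-1` `[c, +oo[%classic).
    exact: mS.
  by apply/seteqP; split=> t /=; rewrite /F /= in_itv /= andbT => // -[].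
have S_nd t : {homo S ^~ t : m n / (m <= n)%N >-> m <= n}.
  apply: homo_leq => [//| |k]; first exact: le_trans.
  by rewrite /S big_ord_recr /= lerDl.
have ndF : nondecreasing_seq F.
  by move=> m n mn; apply/subsetPset => t /= h; exact: le_trans h (S_nd t _ _ mn).
have mbF : measurable (\bigcup_M F M) by exact: bigcupT_measurable.
have KF : K `<=` \bigcup_M F M by move=> t /Hc[M h]; exists M.
have bF : mu (\bigcup_M F M) = 1%E.
  apply/eqP; rewrite eq_le probability_le1 //=.
  have <- : mu K = 1%E.
    by rewrite -[K]setCK probability_setC ?K0 ?sube0 //; exact: measurableC.
  by rewrite le_measure ?inE.
(* The sets [F M] increase to a set of full measure. *)
have [M HM] : exists M, ((2^-1)%:E <= mu (F M))%E.
  apply: contrapT => /forallNP h.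
  have cv : mu \o F @ \oo --> 1%E by rewrite -bF; exact: nondecreasing_cvg_mu.
  have cl : limn (mu \o F) = 1%E by apply/cvg_lim.
  have : (limn (mu \o F) <= (2^-1)%:E)%E.
    apply: lime_le; first by apply/cvg_ex; exists 1%E.
    by apply: nearW => n; rewrite leNgt; apply/negP => /ltW; exact: h.
  by rewrite cl lee_fin; lra.
pose m (i : 'I_M * 'I_(2 ^ M)) := fine (mu (cell_index i)).
have step := integrable_step mu (index_enum _) (fun i : 'I_M * 'I_(2 ^ M) => a i.1 i.2) 0 (mcell M).
have stepF := integrable_step mu [:: tt] (fun=> c) 0 (fun=> mF M).
have cle : c / 2 <= \sum_(i : 'I_M * 'I_(2 ^ M)) a i.1 i.2 * m i.
  apply: le_trans (_ : c * fine (mu (F M)) <= _).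
    rewrite ler_pM2l // -lee_fin fineK ?fin_num_measure //.
  rewrite -[leLHS]addr0 -[leRHS]addr0 -lee_fin -step.2.
  have := stepF.2; rewrite big_seq1 => <-.
  apply: le_integral => //; [exact: stepF.1|exact: step.1|].
  move=> t _; rewrite lee_fin big_seq1 -SE addr0 indicE.
  have [/set_mem h|_] := boolP (t \in F M); first by rewrite mulr1.
  by rewrite mulr0 sumr_ge0.
rewrite (le_trans _ (@log_energy_ge_cells M mu K cK KI K0)) // lee_fin lerB //.
rewrite ler_wpM2l ?ln_ge0 ?ler1n // ler_pdivrMr ?mulr_gt0 //.
(* Chosen so that [th / 2 * D = c / 4], half of the lower bound [c / 2]. *)
pose th := c / (2 * D).
have th0 : 0 < th by rewrite divr_gt0 // mulr_gt0.
have amgm (i : 'I_M * 'I_(2 ^ M)) : a i.1 i.2 * m i <= th / 2 * a i.1 i.2 ^+ 2 + (2 * th)^-1 * m i ^+ 2.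
  have : 0 <= (th * a i.1 i.2 - m i) ^+ 2 / (2 * th).
    by rewrite divr_ge0 ?sqr_ge0 // mulr_ge0 // ltW.
  rewrite (_ : _ / _ = th / 2 * a i.1 i.2 ^+ 2 + (2 * th)^-1 * m i ^+ 2 - a i.1 i.2 * m i).
    by rewrite subr_ge0.
  by field; rewrite gt_eqF.
have : c / 2 <= th / 2 * D + (2 * th)^-1 * \sum_i m i ^+ 2.
  apply: (le_trans cle); apply: (le_trans (ler_sum _ (fun i _ => amgm i))).
  rewrite big_split /= -!mulr_sumr lerD2r; apply: ler_wpM2l; last exact: HD.
  by rewrite divr_ge0 // ltW.
have -> : th / 2 * D = c / 4 by rewrite /th; field; rewrite gt_eqF.
have -> : (2 * th)^-1 = D / c by rewrite /th; field; rewrite !gt_eqF.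
rewrite -/(m) => h.
have : c * (c / 4) <= c * (D / c * \sum_i m i ^+ 2) by rewrite ler_wpM2l ?(ltW c0) //; lra.
have -> : c * (D / c * \sum_i m i ^+ 2) = D * \sum_i m i ^+ 2 by field; rewrite gt_eqF.
by rewrite expr2; lra.
Qed.

(** The energy bound is uniform in [mu] and [K], so it passes to the infimum over measures and the
    supremum over compact subsets. Nonnegativity is recorded because [cap_term] treats capacity [0]
    separately. *)
Lemma log_capacity_tree_le (E : set R) (a : nat -> nat -> R) (c D : R) :
  E `<=` [set t | al <= t <= al + ell] ->
  0 < c -> 0 < D -> (forall k j, 0 <= a k j) ->
  (forall t, E t -> exists M, c <= \sum_(k < M) a k (index k.+1 t)) ->
  (forall M, \sum_(i : 'I_M * 'I_(2 ^ M)) a i.1 i.2 ^+ 2 <= D) ->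
  0 <= log_capacity E <= ell * expR (- (ln 2 * (c ^+ 2 / (4 * D)))).
Proof.
move=> EI c0 D0 a0 Hc HD.
set b := ell * _; have b0 : 0 <= b by rewrite mulr_ge0 ?expR_ge0 // ltW.
have le_b K : compact K -> K `<=` E -> 0 <= cap_compact K <= b.
  move=> cK KE; rewrite /cap_compact; set V := ereal_inf _.
  have : ((ln 2 * (c ^+ 2 / (4 * D)) - ln ell)%:E <= V)%E.
    apply: le_ereal_inf_tmp => _ [mu /= K0 <-].
    by apply: (@log_energy_ge_tree mu K a c D) => // t /KE; [exact: EI|exact: Hc].
  case: V => [r| |] //; last by rewrite lexx.
  rewrite lee_fin expR_ge0 /= => h.
  rewrite /b -[X in X * _](@lnK _ ell) ?posrE // -expRD ler_expR; lra.
have empty : [set cap_compact K | K in [set K : set R | compact K /\ K `<=` E]] (cap_compact set0).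
  by exists set0 => //; split=> //; exact: compact0.
have ub : ubound [set cap_compact K | K in [set K : set R | compact K /\ K `<=` E]] b.
  by move=> _ [K [cK KE] <-]; have /andP[] := le_b K cK KE.
apply/andP; split.
  apply: le_trans (_ : cap_compact set0 <= _).
    by have /andP[] := le_b set0 compact0 (@sub0set _ E).
  by apply: sup_upper_bound => //; split; [exists (cap_compact set0)|exists b].
by apply: ge_sup => //; exists (cap_compact set0).
Qed.

End TreeCapacity.

(** * Increments along the edges *)

Section DyadicEdges.
Variable R : realType.
Implicit Types (al ell : R) (k j : nat).

Definition cell_node al ell k j : R[i] :=
  Complex (al + ell * (j%:R + 2^-1) / 2 ^+ k) (ell / 2 ^+ k).

(* A neighbourhood of the segment from [cell_node k.+1 j] to its parent. *)
Definition edge_box al ell k j (u : R[i]) :=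
  let d := ell / 2 ^+ k.+1 in
  [/\ d * (15 / 16) < complex.Im u < d * (33 / 16) &
      if odd j then d * (j%:R - 16^-1) < complex.Re u - al < d * (j%:R + 9 / 16)
      else d * (j%:R + 7 / 16) < complex.Re u - al < d * (j%:R + 17 / 16)].

(** In units of [d], with abscissas measured from [al], the child is at [(j + 1/2, 1)] and its
    parent at [(j, 2)] or [(j + 1, 2)]. A margin of [1/16] around this edge produces the numbers in
    [edge_box]. *)
Lemma cell_node_parent al ell k j : let d := ell / 2 ^+ k.+1 in
  cell_node al ell k j./2 = Complex (al + d * (if odd j then j%:R else j%:R + 1)) (2 * d).
Proof.
move=> d; have p0 : 2 ^+ k != 0 :> R by rewrite expf_neq0.
rewrite /cell_node /d exprS; apply: complex_ext => /=; last by field.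
have jE : j%:R = (odd j)%:R + (j./2)%:R * 2 :> R.
  by rewrite -[in LHS](odd_double_half j) -muln2 natrD natrM.
by rewrite jE; case: (odd j) => /=; field.
Qed.

Lemma edge_box_segment al ell k j (u : R[i]) (t : R) : 0 < ell -> 0 <= t <= 1 ->
  let z0 := cell_node al ell k j./2 in let z1 := cell_node al ell k.+1 j in
  normc (u - (z0 + (t%:C)%C * (z1 - z0))) < ell / 2 ^+ k.+1 / 16 -> edge_box al ell k j u.
Proof.
move=> ell0 /andP[t0 t1] /=; rewrite cell_node_parent /edge_box.
set d := ell / 2 ^+ k.+1.
have d0 : 0 < d by rewrite divr_gt0 // exprn_gt0.
have -> : cell_node al ell k.+1 j = Complex (al + d * (j%:R + 2^-1)) d.
  by rewrite /cell_node /d; apply: complex_ext => //=; rewrite mulrAC.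
case: u => x y h; have td0 : 0 <= t * d by rewrite mulr_ge0 // ltW.
have td1 : t * d <= d by rewrite ler_piMl // ltW.
have := le_lt_trans (normRe_le _) h; have := le_lt_trans (normIm_le _) h.
rewrite /= !ltr_norml => /andP[y1 y2].
by case: (odd j) => /andP[x1 x2]; split; apply/andP; split; lra.
Qed.

Lemma edge_length al ell k j : 0 < ell ->
  normc (cell_node al ell k.+1 j - cell_node al ell k j./2) <= 2 * (ell / 2 ^+ k.+1).
Proof.
move=> ell0; rewrite cell_node_parent; set d := ell / 2 ^+ k.+1.
have d0 : 0 < d by rewrite divr_gt0 // exprn_gt0.
have -> : cell_node al ell k.+1 j = Complex (al + d * (j%:R + 2^-1)) d.
  by rewrite /cell_node /d; apply: complex_ext => //=; rewrite mulrAC.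
apply: (le_trans (normc_le_ReIm _)) => /=.
rewrite (_ : 2 * d = d / 2 + 3 / 2 * d); last by field.
by case: (odd j); rewrite lerD // ler_norml; apply/andP; split; lra.
Qed.

(** Separates the trees of different [n]. The outermost edges lean inwards, so their margins do not
    cross the ends of the interval. *)
Lemma edge_box_Re al ell k j u : 0 < ell -> (j < 2 ^ k.+1)%N -> edge_box al ell k j u ->
  al < complex.Re u < al + ell.
Proof.
move=> ell0 jk [_]; set d := ell / 2 ^+ k.+1.
have d0 : 0 < d by rewrite divr_gt0 // exprn_gt0.
have E : ell = d * 2 ^+ k.+1 by rewrite /d divfK // expf_neq0.
have jr0 : 0 <= j%:R :> R by [].
case: ifPn => [oj|ej] /andP[h1 h2].
  have j1 : 1 <= j%:R :> R by rewrite ler1n; case: (j) oj.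
  have jr1 : j%:R + 1 <= 2 ^+ k.+1 :> R by rewrite natr1 -natrX ler_nat.
  have := ler_wpM2l (ltW d0) jr1; have := ler_wpM2l (ltW d0) j1.
  by rewrite -E => k1 k2; apply/andP; split; lra.
have jr2 : j%:R + 2 <= 2 ^+ k.+1 :> R.
  rewrite -natrD -natrX ler_nat; rewrite expnS in jk *.
  by move: (2 ^ k)%N jk => p jk; lia.
have := ler_wpM2l (ltW d0) jr2; have := mulr_ge0 (ltW d0) jr0.
by rewrite -E => k1 k2; apply/andP; split; lra.
Qed.

(** The parities are the four colours. Edges on consecutive levels can share a node, and siblings
    share their parent, so their boxes overlap. Levels two apart have [d' <= d / 4], and boxes of
    one level and parity of [j] are translates by multiples of [2 d]. *)
Lemma edge_box_disjoint al ell k k' j j' u : 0 < ell ->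
  odd k = odd k' -> odd j = odd j' ->
  edge_box al ell k j u -> edge_box al ell k' j' u -> (k = k') /\ (j = j').
Proof.
move=> ell0; wlog kk' : k k' j j' / (k <= k')%N.
  move=> H ok oj b1 b2; have [kk|/ltnW kk] := leqP k k'; first exact: H.
  by have [-> ->] := H _ _ _ _ kk (esym ok) (esym oj) b2 b1.
move=> ok oj b1 b2.
have kE : k = k'.
  apply/eqP; rewrite eqn_leq kk' /= leqNgt; apply/negP => lt.
  have k2 : (k.+2 <= k')%N.
    rewrite ltn_neqAle lt andbT; apply/eqP => E; move: ok; rewrite -E /=.
    by case: (odd k).
  case: b1 => /andP[h1 _] _; case: b2 => /andP[_ h2] _.
  set d := ell / 2 ^+ k.+1 in h1; set d' := ell / 2 ^+ k'.+1 in h2.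
  have d0 : 0 < d by rewrite divr_gt0 // exprn_gt0.
  have dd : d' <= d / 4.
    rewrite /d /d' -mulrA -invfM ler_wpM2l ?(ltW ell0) // lef_pV2 ?posrE ?exprn_gt0 ?mulr_gt0 ?exprn_gt0 //.
    rewrite (_ : 2 ^+ k.+1 * 4 = 2 ^+ k.+3); last by rewrite !exprS; ring.
    by rewrite ler_weXn2l // ler1n.
  by lra.
split=> //; subst k'.
wlog jj' : j j' oj b1 b2 / (j <= j')%N.
  move=> H; have [jj|/ltnW jj] := leqP j j'; first exact: H.
  by symmetry; apply: H.
apply/eqP; rewrite eqn_leq jj' /= leqNgt; apply/negP => lt.
have j2 : j%:R + 2 <= j'%:R :> R.
  rewrite -natrD ler_nat addn2 ltn_neqAle lt andbT; apply/eqP => E; move: oj; rewrite -E /=.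
  by case: (odd j).
case: b1 => _; case: b2 => _; rewrite -oj; set d := ell / 2 ^+ k.+1.
have d0 : 0 < d by rewrite divr_gt0 // exprn_gt0.
have := ler_wpM2l (ltW d0) j2.
by case: (odd j) => h1 /andP[h2 h3] /andP[h4 h5]; lra.
Qed.

End DyadicEdges.

Section EdgeSum.
Variable R : realType.
Variables (phi : R[i] -> R[i]) (w0 : R[i]) (eps : R) (al ell : nat -> R).
Hypothesis phi_conf : conformal_on_H phi.
Hypothesis phi_omits : ~ (phi @` upper_half R) w0.
Hypothesis eps0 : 0 < eps.
Hypothesis ell0 : forall n, 0 < ell n.
Hypothesis al_disj : forall n m, (n < m)%N -> al n + ell n <= al m.

(** The value [0] outside the tree matches the rectangular index set of [cell_index]. *)
Definition edge_inc n k j : R := if (j < 2 ^ k.+1)%N then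
  `|clamp_dist phi w0 eps (cell_node (al n) (ell n) k.+1 j)
    - clamp_dist phi w0 eps (cell_node (al n) (ell n) k j./2)| else 0.

Lemma edge_inc_ge0 n k j : 0 <= edge_inc n k j.
Proof. by rewrite /edge_inc; case: ifP. Qed.

(** The range condition comes after [c], so that [choice] yields centres for all triples of
    indices. *)
Lemma edge_inc_disc n k j : exists c, (j < 2 ^ k.+1)%N ->
  forall w, normc (w - c) < edge_inc n k j / (32 * 512) ->
  normc (w - w0) <= expR (6 * distortion_cst R) * eps /\
  exists2 u, phi u = w & 0 < complex.Im u /\ edge_box (al n) (ell n) k j u.
Proof.
have d0 : 0 < ell n / 2 ^+ k.+1 by rewrite divr_gt0 // exprn_gt0.
have [|c Hc] := @edge_disc R phi w0 phi_conf phi_omits eps _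
  (cell_node (al n) (ell n) k j./2) (cell_node (al n) (ell n) k.+1 j) eps0 d0 _ (lexx _)
  (edge_length (al n) k j (ell0 n)).
  rewrite /= exprS ler_wpM2l ?(ltW (ell0 n)) // lef_pV2 ?posrE ?mulr_gt0 ?exprn_gt0 //.
  by rewrite ler_peMl ?exprn_ge0 // ler1n.
exists c => jk w; rewrite /edge_inc jk => /Hc[u uw [[t t01 ut] u0 ww]].
split=> //; exists u => //; split=> //.
exact: edge_box_segment (ell0 n) t01 ut.
Qed.

(** Four colours, times the bound of [disc_packing], times the squared ratio of an increment to the
    radius of its disc. *)
Definition edge_sum_cst : R :=
  4 * ((4 * (expR (6 * distortion_cst R) * eps)) ^+ 2 * (32 * 512) ^+ 2).

Lemma edge_inc_sqr_sum N M :
  \sum_(n < N) \sum_(i : 'I_M * 'I_(2 ^ M)) edge_inc n i.1 i.2 ^+ 2 <= edge_sum_cst.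
Proof.
have [c Hc] := choice (fun p : nat * nat * nat => edge_inc_disc p.1.1 p.1.2 p.2).
rewrite pair_big /=.
pose I : finType := ('I_N * ('I_M * 'I_(2 ^ M)))%type.
pose color (i : I) := (odd i.2.1, odd i.2.2).
rewrite (partition_big color xpredT) //= /edge_sum_cst.
set B := (X in 4 * X).
have -> : 4 * B = \sum_(x : bool * bool) B.
  by rewrite sumr_const (_ : #|_| = 4%N) ?mulr_natl // card_prod card_bool.
apply: ler_sum => x _.
pose P (i : I) := (color i == x) && (i.2.2 < 2 ^ i.2.1.+1)%N.
rewrite (_ : \sum_(i | _) _ = \sum_(i : I | P i) edge_inc i.1 i.2.1 i.2.2 ^+ 2); last first.
  transitivity (\sum_(i : I | color i == x)
      (if (i.2.2 < 2 ^ i.2.1.+1)%N then edge_inc i.1 i.2.1 i.2.2 ^+ 2 else 0)).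
    by apply: eq_bigr => i _; rewrite /edge_inc; case: ifP => //; rewrite expr0n.
  by rewrite -big_mkcondr.
have q0 : 0 < 32 * 512 :> R by rewrite mulr_gt0 ?ltr0n.
rewrite -ler_pdivrMr ?exprn_gt0 // mulr_suml.
under eq_bigr do rewrite -expr_div_n.
apply: (@disc_packing R I P (fun i => c (val i.1, val i.2.1, val i.2.2)) _ w0).
- by rewrite mulr_gt0 ?expR_gt0.
- by move=> i _; rewrite divr_ge0 ?edge_inc_ge0 ?(ltW q0).
- by move=> i w /andP[_ jk] /(Hc (val i.1, val i.2.1, val i.2.2) jk)[].
- move=> i i' w /andP[/eqP ci jk] /andP[/eqP ci' jk'].
  move=> /(Hc (val i.1, val i.2.1, val i.2.2) jk)[_ [u uw [u0 bu]]].
  move=> /(Hc (val i'.1, val i'.2.1, val i'.2.2) jk')[_ [u' uw' [u'0 bu']]].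
  (* A common value of two discs has only one preimage, so the two boxes meet. *)
  have uu' : u' = u by apply: phi_conf.2 => //; rewrite uw uw'.
  rewrite uu' in bu'.
  have /andP[r1 r2] := edge_box_Re (ell0 _) jk bu.
  have /andP[r3 r4] := edge_box_Re (ell0 _) jk' bu'.
  move: ci; rewrite -ci' => -[ck cj].
  move: i i' jk jk' bu bu' r1 r2 r3 r4 ck cj {ci'} => [n [k j]] [n' [k' j']] /=.
  move=> jk jk' bu bu' r1 r2 r3 r4 ck cj.
  have nn : val n = val n'.
    by have [/al_disj h|/al_disj h|//] := ssrnat.ltngtP n n'; exfalso; lra.
  rewrite -nn in bu'.
  have [kk jj] := edge_box_disjoint (ell0 _) ck cj bu bu'.
  by rewrite (val_inj nn) (val_inj kk) (val_inj jj).
Qed.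

End EdgeSum.

(** * The series of capacities *)

Section CapacitySeries.
Variable R : realType.
Variables (phi : R[i] -> R[i]) (w0 : R[i]) (eps : R) (al ell : nat -> R).
Hypothesis phi_conf : conformal_on_H phi.
Hypothesis phi_omits : ~ (phi @` upper_half R) w0.
Hypothesis eps0 : 0 < eps.
Hypothesis ell0 : forall n, 0 < ell n.
Hypothesis al_disj : forall n m, (n < m)%N -> al n + ell n <= al m.

Let inc := edge_inc phi w0 eps al ell.
Let T n M := \sum_(i : 'I_M * 'I_(2 ^ M)) inc n i.1 i.2 ^+ 2.

Lemma edge_energy_nd n : {homo T n : m p / (m <= p)%N >-> m <= p}.
Proof.
have E M : T n M = \sum_(k < M) \sum_(j < 2 ^ k.+1) inc n k j ^+ 2.
  rewrite /T -(pair_big xpredT xpredT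
    (fun (k : 'I_M) (j : 'I_(2 ^ M)) => inc n k j ^+ 2)) /=.
  apply: eq_bigr => k _.
  have le : (2 ^ k.+1 <= 2 ^ M)%N by rewrite leq_exp2l.
  rewrite (big_ord_widen _ (fun j => inc n k j ^+ 2) le) [RHS]big_mkcond /=.
  apply: eq_bigr => j _; rewrite /inc /edge_inc; case: ifP => //.
  by rewrite expr0n.
apply: homo_leq => [//| |M]; first exact: le_trans.
by rewrite !E big_ord_recr /= lerDl; apply: sumr_ge0 => j _; exact: sqr_ge0.
Qed.

(** [D n] is the supremum over all depths plus [2^-n]; the extra term makes it positive, as a
    divisor has to be. *)
Lemma edge_energy_summable : exists D : nat -> R,
  [/\ forall n, 0 < D n, forall n M, T n M <= D n & cvgn (series D)].
Proof.
have total N M : \sum_(n < N) T n M <= edge_sum_cst eps.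
  exact: edge_inc_sqr_sum.
have T0 n M : 0 <= T n M by apply: sumr_ge0 => i _; exact: sqr_ge0.
have ub n M : T n M <= edge_sum_cst eps.
  by apply: le_trans (total n.+1 M); rewrite big_ord_recr /= lerDr sumr_ge0.
have hs n : has_sup (range (T n)).
  by split; [exists (T n 0%N), 0%N|exists (edge_sum_cst eps) => _ [M _ <-]].
have h0 n : 0 < (2 ^+ n)^-1 :> R by rewrite invr_gt0 exprn_gt0.
have exM n : exists M, sup (range (T n)) <= T n M + (2 ^+ n)^-1.
  have [_ [M _ <-] h] := sup_adherent (h0 n) (hs n).
  by exists M; move: h; lra.
have [M HM] := choice exM.
have TD n m : T n m <= sup (range (T n)) by apply: sup_upper_bound => //; exists m.
pose D n := sup (range (T n)) + (2 ^+ n)^-1.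
have D0 n : 0 < D n by rewrite ltr_wpDl // (le_trans (T0 n 0%N)).
exists D; split=> //.
  by move=> n m; apply: le_trans (TD n m) _; rewrite /D lerDl ltW.
have geo N : \sum_(n < N) (2 ^+ n)^-1 <= 2 :> R.
  suff -> : \sum_(n < N) (2 ^+ n)^-1 = 2 - 2 * (2 ^+ N)^-1 :> R.
    by have := h0 N; lra.
  elim: N => [|N ih]; first by rewrite big_ord0 expr0 invr1 mulr1 subrr.
  rewrite big_ord_recr /= ih exprS; field.
  by rewrite expf_neq0.
apply: nondecreasing_is_cvgn.
  apply: homo_leq => [//| |n]; first exact: le_trans.
  by rewrite /series /= big_nat_recr //= lerDl ltW.
exists (edge_sum_cst eps + 4) => _ [N _ <-]; rewrite /series /= big_mkord.
(* [edge_inc_sqr_sum] needs one depth for all trees; at this depth each of the first [N] is within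
   [2^-n] of its supremum. *)
pose Mx := (\max_(n < N) M n)%N.
have : \sum_(n < N) D n <= \sum_(n < N) (T n Mx + 2 * (2 ^+ n)^-1).
  apply: ler_sum => n _.
  have : T n (M n) <= T n Mx by apply: edge_energy_nd; exact: leq_bigmax.
  by have := HM n; rewrite /D; lra.
move=> /le_trans; apply; rewrite big_split /=; apply: lerD; first exact: total.
by rewrite -mulr_sumr; have := geo N; lra.
Qed.

(** Along the branch the truncated distance rises from at most [eps / 2] to at least [3 eps / 4] at
    a single node close to [t], and the increments telescope. *)
Lemma far_set_increments n t :
  normc (phi (Complex (al n + ell n / 2) (ell n)) - w0) <= eps / 2 ->
  far_set phi w0 eps [set t | al n <= t <= al n + ell n] t ->
  exists M, eps / 4 <= \sum_(k < M) inc n k (dyadic_index (al n) (ell n) k.+1 t).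
Proof.
move=> root [/= tI [L [angL0 Lw]]].
(* A node is at horizontal distance at most half its height from [t], inside the sector of slope
   [2]. *)
have gt20 : 0 < 2 :> R by [].
have angL := angL0 2 gt20.
have ln0 := ell0 n.
have e40 : 0 < eps / 4 by rewrite divr_gt0.
pose idx k := dyadic_index (al n) (ell n) k t.
pose z k := cell_node (al n) (ell n) k (idx k).
pose v k := clamp_dist phi w0 eps (z k).
have zE k : complex.Im (z k) = ell n / 2 ^+ k by [].
have p0 k : 0 < 2 ^+ k :> R by rewrite exprn_gt0.
have d0 k : 0 < ell n / 2 ^+ k by rewrite divr_gt0.
have zRe k : `|complex.Re (z k) - t| <= ell n / 2 ^+ k / 2.
  have := dyadic_index_bounds (ell0 n) k tI; rewrite -/(idx k) /z /= => /andP[h1 h2].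
  have E1 : ell n * ((idx k)%:R + 2^-1) / 2 ^+ k =
     (idx k)%:R * ell n / 2 ^+ k + ell n / 2 ^+ k / 2 by field; rewrite gt_eqF.
  have E2 : ((idx k)%:R + 1) * ell n / 2 ^+ k =
     (idx k)%:R * ell n / 2 ^+ k + ell n / 2 ^+ k by field; rewrite gt_eqF.
  by rewrite E1; rewrite E2 in h2; rewrite ler_norml; apply/andP; split; lra.
have stolz_z k : stolz t 2 (z k).
  by split; rewrite zE //; apply: le_lt_trans (zRe k) _; have := d0 k; lra.
have [r r0 Hr] : exists2 r : R, 0 < r & forall w, normc (w - Complex t 0) < r ->
    stolz t 2 w -> normc (phi w - L) < eps / 4.
  move: angL => /(@cvg_normcP _ _ (within (stolz t 2) (nbhs (Complex t 0 : R[i]^o))))/(_ _ e40).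
  by move=> /nbhs_normcP[r r0 Hr]; exists r.
have [M HM] := half_expn_small (ell n * 2) r0.
have Lfar : eps <= normc (L - w0) by move: Lw; rewrite normr_normc lecR.
have vM : eps * (3 / 4) <= v M.
  have : normc (phi (z M) - L) < eps / 4.
    apply: Hr; last exact: stolz_z.
    apply: le_lt_trans HM; apply: (le_trans (normc_le_ReIm _)).
    have hR : `|complex.Re (z M - Complex t 0)| <= ell n / 2 ^+ M / 2.
      by rewrite raddfB; exact: zRe.
    have -> : `|complex.Im (z M - Complex t 0)| = ell n / 2 ^+ M.
      by rewrite raddfB /= subr0 ger0_norm // ltW.
    by have := d0 M; lra.
  have := normc_dist_le (phi (z M)) L w0; rewrite [normc (L - phi _)]normc_distC => h1 h2.
  by rewrite /v /clamp_dist le_min; apply/andP; split; lra.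
have v0 : v 0%N <= eps / 2.
  rewrite /v /clamp_dist ge_min; apply/orP; left; apply: le_trans root.
  have -> : z 0%N = Complex (al n + ell n / 2) (ell n).
    have idx0 : idx 0%N = 0%N by rewrite /idx /dyadic_index expn0 minn0.
    by rewrite /z idx0 /cell_node expr0; apply: complex_ext => /=; field.
  by [].
exists M; apply: le_trans (_ : v M - v 0%N <= _); first by lra.
elim: M {HM vM} => [|M ih]; first by rewrite subrr big_ord0.
have -> : v M.+1 - v 0%N = (v M - v 0%N) + (v M.+1 - v M) by ring.
rewrite big_ord_recr /=; apply: lerD => //.
apply: (le_trans (ler_norm _)); rewrite /inc /edge_inc dyadic_index_lt.
by rewrite dyadic_index_half //; case/andP: tI.
Qed.

(** [kap] allows for a normalisation other than the length of the interval, such as [lam^n] in (a).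
    It only shifts the logarithm by [ln kap], negligible against [k0 / D n] because [D n] tends to
    [0]. *)
Lemma capacity_series_cvg (kap : R) : 0 < kap ->
  (forall e : R, 0 < e -> exists N, forall n, (N <= n)%N ->
     normc (phi (Complex (al n + ell n / 2) (ell n)) - w0) <= e) ->
  cvgn (series (fun n => cap_term
    (log_capacity (far_set phi w0 eps [set t | al n <= t <= al n + ell n])) (kap * ell n))).
Proof.
move=> kap0 root.
have [D [D0 TD cD]] := edge_energy_summable.
have e20 : 0 < eps / 2 by rewrite divr_gt0.
have [N1 HN1] := root _ e20.
pose k0 : R := ln 2 * ((eps / 4) ^+ 2 / 4).
have k00 : 0 < k0 by rewrite mulr_gt0 ?ln_gt0 ?ltr1n // divr_gt0 // exprn_gt0 // divr_gt0.
pose u n := cap_term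
    (log_capacity (far_set phi w0 eps [set t | al n <= t <= al n + ell n])) (kap * ell n).
(* Below this threshold [|ln kap| <= k0 / (2 D n)], so half of [k0 / D n] survives; the [1] guards
   against [ln kap = 0]. *)
have d0 : 0 < k0 / (2 * (`|ln kap| + 1)) by rewrite divr_gt0 // mulr_gt0 // ltr_wpDl.
have [N2 HN2] : exists N2, forall n, (N2 <= n)%N -> D n < k0 / (2 * (`|ln kap| + 1)).
  have /cvgrPdist_lt/(_ _ d0)[N2 _ HN] := cvg_series_cvg_0 cD.
  exists N2 => n /HN; rewrite sub0r normrN; exact/le_lt_trans/ler_norm.
pose N := maxn N1 N2.
have u_le n : (N <= n)%N -> 0 <= u n <= 2 / k0 * D n.
  rewrite geq_max => /andP[n1 n2].
  have e40 : 0 < eps / 4 by rewrite divr_gt0.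
  have := @log_capacity_tree_le R (al n) (ell n) (ell0 n)
    (far_set phi w0 eps [set t | al n <= t <= al n + ell n]) (inc n) (eps / 4) (D n)
    (fun t h => h.1) e40 (D0 n) (edge_inc_ge0 _ _ _ _ _ n)
    (fun t => far_set_increments (HN1 n n1)) (TD n).
  rewrite /u /cap_term; set c := log_capacity _ => /andP[c0 cle].
  case: eqVneq => [_|cn0].
    by rewrite lexx mulr_ge0 ?divr_ge0 ?(ltW k00) ?(ltW (D0 n)).
  have {}c0 : 0 < c by rewrite lt_def cn0 c0.
  have ln_ge : ln kap + k0 / D n <= ln (kap * ell n / c).
    rewrite -ler_expR expRD !lnK ?posrE ?divr_gt0 ?mulr_gt0 //.
    rewrite ler_pdivlMr // -mulrA ler_wpM2l ?(ltW kap0) //.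
    apply: le_trans (ler_wpM2l (expR_ge0 _) cle) _.
    rewrite mulrCA -expRD (_ : _ - _ = 0) ?expR0 ?mulr1 //.
    by rewrite /k0; field; rewrite gt_eqF.
  have Dn := HN2 n n2.
  have k1 : `|ln kap| <= k0 / (2 * D n).
    rewrite ler_pdivlMr ?mulr_gt0 //; move: Dn; rewrite ltr_pdivlMr; last first.
      by rewrite mulr_gt0 // ltr_wpDl.
    by have := D0 n; have := normr_ge0 (ln kap); nra.
  have k2 : k0 / D n = k0 / (2 * D n) + k0 / (2 * D n) by field; rewrite gt_eqF.
  have k3 : 0 < k0 / (2 * D n) by rewrite divr_gt0 // mulr_gt0.
  have k4 : - `|ln kap| <= ln kap by rewrite lerNl -normrN ler_norm.
  have k5 : k0 / (2 * D n) <= ln (kap * ell n / c) by lra.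
  apply/andP; split; first by rewrite invr_ge0; lra.
  rewrite (_ : 2 / k0 * D n = (k0 / (2 * D n))^-1); last by field; rewrite !gt_eqF.
  by rewrite lef_pV2 ?posrE //; lra.
(* The first [N] terms are not controlled, not even in sign; replacing them does not affect
   convergence. *)
pose u' n := if (N <= n)%N then u n else 0.
rewrite -/u -(is_cvg_series_restrict N).
rewrite (_ : (fun n => _) = [sequence \sum_(N <= k < n) u' k]_n); last first.
  apply/funext => n /=; apply: eq_big_nat => k /andP[Nk _].
  by rewrite /u' Nk.
rewrite is_cvg_series_restrict.
apply: (@series_le_cvg _ u' (fun n => 2 / k0 * D n)).
- by move=> n; rewrite /u'; case: ifP => // /u_le/andP[].
- by move=> n; rewrite mulr_ge0 ?divr_ge0 ?(ltW k00) ?(ltW (D0 n)).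
- move=> n; rewrite /u'; case: ifP => [/u_le/andP[]//|_].
  by rewrite mulr_ge0 ?divr_ge0 ?(ltW k00) ?(ltW (D0 n)).
- exact: is_cvg_seriesZ cD.
Qed.

End CapacitySeries.

Lemma cvg_normc_eventually (R : realType) (f : nat -> R[i]) (w0 : R[i]) :
  (f : nat -> R[i]^o) @ \oo --> (w0 : R[i]^o) ->
  forall e : R, 0 < e -> exists N, forall n, (N <= n)%N -> normc (f n - w0) <= e.
Proof.
move=> /(@cvg_normcP R nat \oo _ f w0) H e e0; have [N _ HN] := H e e0.
by exists N => n nN; apply/ltW; exact: HN.
Qed.

Theorem theorem3p1 (R : realType) (phi : R[i] -> R[i]) (w0 : R[i]) (lam eps : R) :
  conformal_on_H phi ->
  ~ (phi @` upper_half R) w0 ->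
  1 < lam -> 0 < eps ->
  (* (a) *)
  ((fun n : nat => (phi (Complex 0 (lam ^+ n)) : R[i]^o)) @ \oo --> (w0 : R[i]^o) ->
     cvg (series (fun n : nat =>
       cap_term (log_capacity (far_set phi w0 eps (I_int lam n))) (lam ^+ n)) @ \oo))
  /\
  (* (b) *)
  ((fun n : nat => (phi (Complex n%:R 1) : R[i]^o)) @ \oo --> (w0 : R[i]^o) ->
     cvg (series (fun n : nat =>
       cap_term (log_capacity (far_set phi w0 eps (@J_int R n))) 1) @ \oo)).
Proof.
move=> conf omits lam1 eps0; split=> /cvg_normc_eventually lim.
  have lam0 : 0 < lam by exact: lt_trans lam1.
  (* With the square root [s] of [lam], [I_n] runs from [lam^n / s] to [lam^n s]; consecutive
     intervals share an endpoint. *)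
  pose s := lam `^ 2^-1.
  have sqs : s * s = lam by rewrite -expr2 /s powR12_sqrt ?sqr_sqrtr ?ltW.
  have s1 : 1 < s.
    rewrite ltNge; apply/negP => s_le1; have sp : 0 <= s by exact: powR_ge0.
    have : s * s <= 1 * 1 by rewrite ler_pM.
    by rewrite sqs mulr1 leNgt lam1.
  have s0 : 0 < s by exact: lt_trans s1.
  have ss : 0 < s - s^-1.
    by rewrite subr_gt0; apply: (lt_trans _ s1); rewrite invf_lt1.
  have p0 n : 0 < lam ^+ n by rewrite exprn_gt0.
  pose al n := lam ^+ n / s; pose ell n := lam ^+ n * (s - s^-1).
  have I_E n : I_int lam n = [set t | al n <= t <= al n + ell n].
    have -> : al n + ell n = lam `^ (n%:R + 2^-1).
      rewrite powRD ?(gt_eqF lam0) ?implybT // powR_mulrn ?(ltW lam0) // -/s.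
      by rewrite /al /ell; field; rewrite gt_eqF.
    have -> : al n = lam `^ (n%:R - 2^-1).
      by rewrite powRD ?(gt_eqF lam0) ?implybT // powR_mulrn ?(ltW lam0) // powRN.
    by [].
  have al_disj n m : (n < m)%N -> al n + ell n <= al m.
    move=> nm; rewrite [al m]/al ler_pdivlMr //.
    rewrite (_ : _ * s = lam ^+ n.+1).
      by rewrite ler_weXn2l // ltW.
    rewrite exprSr -[X in _ = _ * X]sqs /al /ell.
    by field; rewrite gt_eqF.
  have ell0 n : 0 < ell n by rewrite mulr_gt0.
  have := @capacity_series_cvg R phi w0 eps al ell conf omits eps0 ell0 al_disj
    (s - s^-1)^-1.
  have num n : (s - s^-1)^-1 * ell n = lam ^+ n.
    by rewrite /ell mulrCA mulVf ?mulr1 // gt_eqF.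
  under eq_fun do rewrite num -I_E.
  apply; first by rewrite invr_gt0.
  (* The hypothesis concerns [lam^n i], not the root of the tree. Both points scale with [lam^n]:
     their heights are at least [lam^n m1] and their distance at most [lam^n c1], so the Harnack
     factor [K] is independent of [n]. *)
  pose m1 := Num.min 1 (s - s^-1).
  have m10 : 0 < m1 by rewrite lt_min ltr01 ss.
  pose c1 := (s^-1 + (s - s^-1) / 2) + `|s - s^-1 - 1|.
  pose K := expR (distortion_cst R * c1 / m1).
  have K0 : 0 < K by exact: expR_gt0.
  move=> e e0; have [N HN] := lim (e / K) (divr_gt0 e0 K0).
  exists N => n /HN; rewrite ler_pdivlMr // mulrC; apply: le_trans.
  have -> : K = expR (distortion_cst R * (lam ^+ n * c1) / (lam ^+ n * m1)).
    by congr expR; field; rewrite !gt_eqF.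
  apply: harnack => //.
  - by rewrite mulr_gt0.
  - by rewrite /= ler_piMr ?(ltW (p0 n)) // ge_min lexx.
  - by rewrite /= /ell ler_wpM2l ?(ltW (p0 n)) // ge_min lexx orbT.
  - rewrite (le_trans (normc_le_ReIm _)) //= subr0.
    have -> : al n + ell n / 2 = lam ^+ n * (s^-1 + (s - s^-1) / 2).
      by rewrite /al /ell; field; rewrite gt_eqF.
    have -> : ell n - lam ^+ n = lam ^+ n * (s - s^-1 - 1) by rewrite /ell; ring.
    rewrite !normrM (gtr0_norm (p0 n)) -mulrDr /c1.
    rewrite [X in _ * (X + _)]ger0_norm // addr_ge0 ?invr_ge0 ?(ltW s0) //.
    by rewrite divr_ge0 // ltW.
(* In (b) the roots are exactly the points [n + i] of the hypothesis. *)
pose al n : R := n%:R - 2^-1.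
have al_disj n m : (n < m)%N -> al n + 1 <= al m.
  by move=> nm; rewrite /al addrAC natr1 lerB // ler_nat.
have := @capacity_series_cvg R phi w0 eps al (fun=> 1) conf omits eps0 (fun=> ltr01)
  al_disj 1 ltr01.
have mid n : al n + 1 / 2 = n%:R by rewrite /al; field.
have J_E n : [set t | al n <= t <= al n + 1] = J_int n.
  by rewrite /J_int /al; have -> : n%:R - 2^-1 + 1 = n%:R + 2^-1 :> R by field.
rewrite mulr1; under eq_fun do rewrite J_E.
apply=> e /lim[N HN]; exists N => n nN; rewrite mid; exact: HN.
Qed.
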